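(* Let $G$ be an infinite $R$-analytic profinite group, and let $(S,\phi)$ and $(T,\psi)$ be two open $R$-standard subgroups of $G$. Then \[ \operatorname{hDim}_{\{\mathfrak m^n_\phi S\}}(H)=\operatorname{hDim}_{\{\mathfrak m^n_\psi T\}}(H) \] for every closed subgroup $H$ of $G$.
   Context: Throughout, $R$ is a pro-$p$ ring, i.e. a commutative Noetherian complete local ring with maximal ideal $\mathfrak m$ and finite residue field $R/\mathfrak m$ of characteristic $p$, and its associated graded ring $\bigoplus_{n\ge 0}\mathfrak m^n/\mathfrak m^{n+1}$ is assumed to be an integral domain. Hence $R$ is an integral domain; $K$ denotes its field of fractions. $X^{(d)}$ denotes the cartesian product of $d$ copies of a set $X$. $R$-analytic manifolds and groups (in the sense of Dixon, du Sautoy, Mann, Segal, ''Analytic pro-$p$ groups'', Chapter 13). Put $|0|=0$ and $|x|=c^{-n}$ for $x\in\mathfrak m^n\smallsetminus\mathfrak m^{n+1}$ ($c>1$ fixed); this extends to an absolute value on $K$. A function from an open subset $V$ of $R^{(r)}$ to $R^{(s)}$ is analytic if near each point $y\in V$, i.e. on $y+(\mathfrak m^{\ell})^{(r)}$ for some $\ell$, its components are given by formal power series over $K$ in the coordinates of $x-y$ that converge there. An $R$-analytic manifold of dimension $d$ is a topological space with a full (maximal) atlas of charts $(U,\phi)$, $\phi$ a homeomorphism of the open set $U$ onto an open subset of $R^{(d)}$, with analytic transition functions. An $R$-analytic group is a topological group that is an $R$-analytic manifold with analytic multiplication and inversion. An $R$-analytic profinite group is an $R$-analytic group that is profinite as a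 topological group. Standard groups. An $R$-standard group $(S,\phi)$ of level $N\ge 1$ is an $R$-analytic group $S$ with a global chart given by a homeomorphism $\phi:S\to(\mathfrak m^N)^{(d)}$ such that $\phi(1)=0$ and there are power series $F_1,\dots,F_d\in R[[X,Y]]$ ($X,Y$ being $d$-tuples of indeterminates) without constant term such that $\phi(xy)=F(\phi(x),\phi(y))$ for all $x,y\in S$, where $F=(F_1,\dots,F_d)$. An open standard subgroup of $G$ is an open subgroup $S$ with a chart $(S,\phi)$ of $G$ (belonging to the full atlas of $G$) making it an $R$-standard group. Put $\mathfrak m^n_\phi S=\phi^{-1}((\mathfrak m^{N+n})^{(d)})$ for $n\ge 0$, where $N$ is the level of $(S,\phi)$. These are open subgroups of $G$, and $\{\mathfrak m^n_\phi S\}_{n}$ is a filtration of $G$, the natural filtration of $G$ induced by $S$. The levels of $(S,\phi)$ and $(T,\psi)$ may differ. Hausdorff dimension. A filtration of a countably based infinite profinite group $G$ is a descending series $\{G_n\}$ of open subgroups of $G$ forming a base of neighbourhoods of $1$. It defines the metric $d(x,y)=\inf\{|G:G_n|^{-1}\mid xy^{-1}\in G_n\}$ (with $d(x,y)=1$ if $xy^{-1}$ lies in no $G_n$), and $\operatorname{hDim}_{\{G_n\}}(X)$ is the Hausdorff dimension of $X\subseteq G$ with respect to this metric. $R$-analytic profinite groups are countably based. *)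

(* Defs.v *)
From HB Require Import structures.
From mathcomp Require Import all_boot all_order all_algebra.
From mathcomp Require Import finmap.
From mathcomp Require Import all_classical all_reals all_analysis.

Set Implicit Arguments.
Unset Strict Implicit.
Unset Printing Implicit Defensive.

Import Order.TTheory GRing.Theory Num.Theory.
Local Open Scope classical_set_scope.
Local Open Scope ring_scope.

(** * Ideals and pro-p rings *)

Section CommutativeRings.
Variable R : comNzRingType.
Implicit Types (I J m : set R).

Definition is_ideal I : Prop :=
  [/\ I 0, forall x y, I x -> I y -> I (x + y) & forall a x, I x -> I (a * x)].

Definition maximal_ideal I : Prop :=
  [/\ is_ideal I, I != setT &
      forall J, is_ideal J -> I `<=` J -> J = I \/ J = setT].

Fixpoint ideal_exp I (n : nat) : set R :=
  if n is k.+1 then smallest is_ideal [set x * y | x in I & y in ideal_exp I k]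
  else setT.

Definition local_ring m : Prop :=
  maximal_ideal m /\ forall J, maximal_ideal J -> J = m.

Definition noetherian : Prop :=
  forall I, is_ideal I -> exists s : seq R, I = smallest is_ideal [set` s].

Definition adic_cauchy m (u : nat -> R) : Prop :=
  forall n, exists N, forall i j, (N <= i)%N -> (N <= j)%N ->
    ideal_exp m n (u i - u j).

Definition adic_cvg_to m (u : nat -> R) (l : R) : Prop :=
  forall n, exists N, forall i, (N <= i)%N -> ideal_exp m n (u i - l).

Definition adic_complete m : Prop :=
  \bigcap_n ideal_exp m n = [set 0] /\
  forall u, adic_cauchy m u -> exists l, adic_cvg_to m u l.

(* The underlying set of the quotient R / I. *)
Definition quotient_set I : set (set R) := range (fun x => [set y | I (y - x)]).

(* [m] is carried along as the name of the maximal ideal, of which [local_ring]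
   asserts the uniqueness. *)
Record pro_p_ring (p : nat) m : Prop := ProPRing {
  pro_p_local : local_ring m;
  pro_p_noetherian : noetherian;
  pro_p_complete : adic_complete m;
  pro_p_prime : prime p;
  pro_p_finite_residue : finite_set (quotient_set m);
  pro_p_residue_char : m p%:R }.

(* The associated graded ring gr(R) = (+)_n m^n / m^(n+1) is the quotient of the
   Rees ring { a in R[t] | a_n in m^n for all n } by its ideal
   { a | a_n in m^(n+1) for all n }: the class of a is the family of the classes
   of the a_n, and the multiplication of polynomials induces that of gr(R). *)
Definition rees_mem m (a : {poly R}) : Prop := forall n, ideal_exp m n a`_n.
Definition gr_zero m (a : {poly R}) : Prop := forall n, ideal_exp m n.+1 a`_n.

Definition gr_integral_domain m : Prop :=
  ~ gr_zero m 1 /\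
  forall a b, rees_mem m a -> rees_mem m b ->
    gr_zero m (a * b) -> gr_zero m a \/ gr_zero m b.

End CommutativeRings.

(** * Convergent power series and analytic functions *)

Definition multi_index (r : nat) := {ffun 'I_r -> nat}.

Definition power_series (r : nat) (A : Type) := multi_index r -> A.

Section Analytic.
Variables (RR : realType) (c : RR) (R : idomainType) (m : set R).

(* The [n] with [x] in [m^n] but not in [m^(n+1)]; meaningful for [x != 0]. *)
Definition adic_order (x : R) : nat :=
  xget 0%N [set n | ideal_exp m n x /\ ~ ideal_exp m n.+1 x].

Definition adic_abs (x : R) : RR := if x == 0 then 0 else c ^- adic_order x.

Definition frac_abs (x : {fraction R}) : RR :=
  adic_abs (frac (repr x)).1 / adic_abs (frac (repr x)).2.

Definition monomial_at r (z : 'rV[{fraction R}]_r) (a : multi_index r) :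
  {fraction R} := \prod_(j < r) z 0 j ^+ a j.

(* The family of the terms of the series at [z] is summable with sum [l]:
   convergence along the directed set of the finite sets of multi-indices. *)
Definition series_sum_at r (F : power_series r {fraction R})
    (z : 'rV[{fraction R}]_r) (l : {fraction R}) : Prop :=
  forall e : RR, 0 < e -> exists A0 : {fset multi_index r},
    forall A : {fset multi_index r}, (A0 `<=` A)%fset ->
      frac_abs (\sum_(a <- A) F a * monomial_at z a - l) < e.

Definition vec_in r (I : set R) (x : 'rV[R]_r) : Prop := forall j, I (x 0 j).

(* Open subsets of R^(r) for the product of the m-adic topologies. *)
Definition adic_open r (V : set 'rV[R]_r) : Prop :=
  forall y, V y -> exists l : nat,
    forall x, vec_in (ideal_exp m l) (x - y) -> V x.

(* Only the values of [f] on [V] matter. *)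
Definition analytic_on r s (V : set 'rV[R]_r) (f : 'rV[R]_r -> 'rV[R]_s) :
  Prop :=
  forall y, V y -> exists (l : nat) (F : 'I_s -> power_series r {fraction R}),
    forall x, vec_in (ideal_exp m l) (x - y) -> V x /\
      forall i, series_sum_at (F i) (map_mx (@tofrac R) (x - y))
        (tofrac (f x 0 i)).

(** * Analytic manifolds *)

(* [(U, phi)]; only the values of [phi] on [U] matter. *)
Definition chart (d : nat) (M : Type) : Type := (set M * (M -> 'rV[R]_d))%type.

(* Taking W = U gives that phi(U) is open. *)
Definition is_chart d (M : topologicalType) (u : chart d M) : Prop :=
  [/\ open u.1, {in u.1 &, injective u.2} &
      forall W, W `<=` u.1 -> open W <-> adic_open (u.2 @` W)].

(* f read in the charts (U, phi) and (V, psi): g is psi o f o phi^-1 on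
   phi(U `&` f^-1(V)), which is part of what is required to be open. *)
Definition analytic_in_charts d e (M N : Type) (u : chart d M) (v : chart e N)
    (f : M -> N) : Prop :=
  let D := u.1 `&` f @^-1` v.1 in
  exists g : 'rV[R]_d -> 'rV[R]_e,
    (forall x, D x -> g (u.2 x) = v.2 (f x)) /\ analytic_on (u.2 @` D) g.

Definition compatible_charts d (M : Type) (u v : chart d M) : Prop :=
  analytic_in_charts u v id /\ analytic_in_charts v u id.

Record full_atlas d (M : topologicalType) (A : set (chart d M)) : Prop :=
  FullAtlas {
    atlas_chart : forall u, A u -> is_chart u;
    atlas_cover : \bigcup_(u in A) u.1 = setT;
    atlas_compatible : forall u v, A u -> A v -> compatible_charts u v;
    atlas_maximal : forall u, is_chart u ->
      (forall v, A v -> compatible_charts u v) -> A u }.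

Definition analytic_map d e (M N : Type) (A : set (chart d M))
    (B : set (chart e N)) (f : M -> N) : Prop :=
  forall u v, A u -> B v -> analytic_in_charts u v f.

Definition prod_chart d e (M N : Type) (u : chart d M) (v : chart e N) :
  chart (d + e) (M * N) := (u.1 `*` v.1, fun x => row_mx (u.2 x.1) (v.2 x.2)).

(* Not the full atlas of the product manifold, but one generating it. *)
Definition prod_atlas d e (M N : Type) (A : set (chart d M))
    (B : set (chart e N)) : set (chart (d + e) (M * N)) :=
  [set prod_chart u v | u in A & v in B].

End Analytic.

(** * Topological groups *)

HB.mixin Record Topological_Group_isTopologicalGroup G
    & Topological G & Group G := {
  mulg_continuous : continuous (fun x : G * G => (x.1 * x.2)%g);
  invg_continuous : continuous (fun x : G => (x^-1)%g) }.

#[short(type="topologicalGroupType")]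
HB.structure Definition TopologicalGroup :=
  { G of Topological G & Group G & Topological_Group_isTopologicalGroup G }.

Definition is_subgroup (G : groupType) (H : set G) : Prop :=
  [/\ H 1%g, forall x y, H x -> H y -> H (x * y)%g & forall x, H x -> H (x^-1)%g].

Definition profinite (G : topologicalGroupType) : Prop :=
  [/\ compact [set: G], hausdorff_space G & totally_disconnected [set: G]].

(** * Analytic and standard groups *)

Section AnalyticGroups.
Variables (RR : realType) (c : RR) (R : idomainType) (m : set R).
Variables (G : topologicalGroupType) (d : nat).

Record analytic_group (A : set (chart R d G)) : Prop := AnalyticGroup {
  analytic_group_atlas : full_atlas c m A;
  analytic_group_mul :
    analytic_map c m (prod_atlas A A) A (fun x : G * G => (x.1 * x.2)%g);
  analytic_group_inv : analytic_map c m A A (fun x : G => (x^-1)%g) }.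

(* [(S, phi)] is an open standard subgroup, of level [N], of the analytic group
   [G] with full atlas [A]; its structure of analytic group is that of an open
   subgroup of [G]. *)
Record open_standard_subgroup (A : set (chart R d G)) (S : set G)
    (phi : G -> 'rV[R]_d) (N : nat) : Prop := OpenStandardSubgroup {
  standard_subgroup : is_subgroup S;
  standard_open : open S;
  standard_chart : A (S, phi);
  standard_level : (1 <= N)%N;
  standard_image : phi @` S = [set v | vec_in (ideal_exp m N) v];
  standard_one : phi 1%g = 0;
  standard_mul : exists F : 'I_d -> power_series (d + d) R,
    (forall i, F i [ffun=> 0%N] = 0) /\
    forall x y, S x -> S y -> forall i,
      series_sum_at c m (fun a => tofrac (F i a))
        (map_mx (@tofrac R) (row_mx (phi x) (phi y))) (tofrac (phi (x * y)%g 0 i)) }.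

(* m^n_phi S *)
Definition natural_filtration (S : set G) (phi : G -> 'rV[R]_d) (N : nat)
    (n : nat) : set G :=
  [set x | S x /\ vec_in (ideal_exp m (N + n)) (phi x)].

End AnalyticGroups.

(** * Hausdorff dimension *)

Section HausdorffDimension.
Variables (RR : realType) (T : Type) (dist : T -> T -> RR).
Local Open Scope ereal_scope.
Implicit Types (E X : set T) (s delta : RR).

Definition diameter E : \bar RR :=
  ereal_sup [set (dist x y)%:E | x in E & y in E].

(* diam(E)^s, with value 0 on the empty set even for s = 0. *)
Definition diameter_pow s E : \bar RR :=
  if E == set0 then 0 else poweR (diameter E) s.

Definition hausdorff_premeasure delta s X : \bar RR :=
  ereal_inf [set \sum_(0 <= i <oo) diameter_pow s (E i) |
    E in [set E : nat -> set T |
      X `<=` \bigcup_i E i /\ forall i, diameter (E i) <= delta%:E]].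

Definition hausdorff_measure s X : \bar RR :=
  ereal_sup [set hausdorff_premeasure delta s X |
    delta in [set delta | (0 < delta)%R]].

Definition hausdorff_dim X : \bar RR :=
  ereal_inf [set s%:E | s in [set s | (0 <= s)%R /\ hausdorff_measure s X = 0]].

End HausdorffDimension.

Section FiltrationMetric.
Variables (RR : realType) (G : groupType) (F : nat -> set G).

(* |G : U|, as the number of right cosets of U; meaningful for finite index. *)
Definition group_index (U : set G) : nat :=
  #|` fset_set (range (fun x : G => [set (u * x)%g | u in U]))|.

Definition filtration_dist (x y : G) : RR :=
  if `[< exists n, F n (x * y^-1)%g >]
  then inf [set ((group_index (F n))%:R)^-1 | n in [set n | F n (x * y^-1)%g]]
  else 1.

Definition hDim (X : set G) : \bar RR := hausdorff_dim filtration_dist X.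

End FiltrationMetric.

(* Main.v *)
(* The change of charts between the two standard subgroups is analytic and fixes 0,
   hence Lipschitz near 0, so there is a k with m^(n+k)_phi S contained in m^n_psi T
   for all n, and symmetrically. Since |G : m^n_phi S| is, up to a constant factor,
   |R : m^(N+n)|^d, the two metrics are compared through the growth of |R : m^n|.
   Counting standard monomials shows that a_n = |m^n : m^(n+1)| satisfies
   a_n^n <= |R : m^n|^s, where s is the number of generators of m; therefore
   |R : m^(n+k)| <= C |R : m^n|^(1+e) for every e > 0. So the identity map is Hoelder
   of exponent 1/(1+e) for every e > 0 in both directions, and it preserves the
   Hausdorff dimension of every subset of G. *)
Require Import Defs.
From HB Require Import structures.
From mathcomp Require Import all_boot all_order all_algebra.
From mathcomp Require Import finmap.
From mathcomp Require Import all_classical all_reals all_analysis.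
From mathcomp Require Import zify ring lra.
Set Implicit Arguments.
Unset Strict Implicit.
Unset Printing Implicit Defensive.
Import Order.TTheory GRing.Theory Num.Theory.
Local Open Scope classical_set_scope.
Local Open Scope ring_scope.

(** * Hausdorff dimension under Hoelder maps *)

(** The obstacle is the shift k. For R = Z_p[[t]] one has |m^n : m^(n+1)| = p^(n+1), so a shift
    multiplies the indices by an unbounded factor, and the inclusions of the filtrations alone give
    no Lipschitz bound between the metrics; hence the exponents 1 + e, with e arbitrarily small. The
    two kinds of power series behave differently. The group laws have coefficients in R and preserve
    congruences modulo m^n without loss, which yields the indices. The change of charts has
    coefficients in K, and bounding them costs the shift k. Since the graded ring is a domain, the
    order function is a valuation on R and extends to K, so that such series can be estimated term
    by term with the ultrametric inequality. *)

Section HolderComparison.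
Variables (RR : realType) (T : Type).
Implicit Types (X E : set T) (s e C : RR).
Local Open Scope ereal_scope.

Lemma diameter_ge0 (d : T -> T -> RR) E :
  (forall x y, (0 <= d x y)%R) -> E != set0 -> 0 <= diameter d E.
Proof.
move=> d0 /set0P[x Ex]; apply: (@le_trans _ _ (d x x)%:E); first by rewrite lee_fin.
by apply: ereal_sup_ubound; exists x => //; exists x.
Qed.

Lemma diameter_pow_ge0 (d : T -> T -> RR) s E : 0 <= diameter_pow d s E.
Proof. by rewrite /diameter_pow; case: ifP => // _; exact: poweR_ge0. Qed.

Lemma hausdorff_premeasure_ge0 (d : T -> T -> RR) (delta : RR) s X :
  0 <= hausdorff_premeasure d delta s X.
Proof.
apply: le_ereal_inf_tmp => _ [E _ <-]; apply: nneseries_ge0 => n _ _.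
exact: diameter_pow_ge0.
Qed.

Lemma hausdorff_measure_eq0 (d : T -> T -> RR) s X :
  hausdorff_measure d s X = 0 <->
  forall delta e : RR, (0 < delta)%R -> (0 < e)%R ->
    exists E : nat -> set T,
    [/\ X `<=` \bigcup_i E i, forall i, diameter d (E i) <= delta%:E &
        \sum_(0 <= i <oo) diameter_pow d s (E i) < e%:E].
Proof.
split=> [X0 delta e delta0 e0|XE].
  have : hausdorff_premeasure d delta s X < e%:E.
    apply: (@le_lt_trans _ _ 0); last by rewrite lte_fin.
    by rewrite -X0; apply: ereal_sup_ubound; exists delta.
  by move=> /ereal_inf_lt[_ [E [XE Ed] <-] Ee]; exists E.
apply/eqP; rewrite eq_le; apply/andP; split; last first.
  apply: (le_trans (hausdorff_premeasure_ge0 d 1 s X)).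
  by apply: ereal_sup_ubound; exists 1%R => //=.
apply: ge_ereal_sup => _ [delta /= delta0 <-].
apply/lee_addgt0Pr => e e0; rewrite add0e.
have [E [XE' Ed Ee]] := XE delta e delta0 e0.
apply: le_trans (ltW Ee); apply: ereal_inf_lbound; exists E => //.
Qed.

(** Moves the power to the other side, so that a bound on a power of a diameter can be checked on
    single distances, below the supremum. *)
Lemma lee_poweRl (x y : \bar RR) (r : RR) : (0 < r)%R -> 0 <= x -> 0 <= y ->
  (x `^ r <= y) = (x <= y `^ r^-1).
Proof.
move=> r0 x0 y0; have homo t : (0 <= t)%R -> forall u v : \bar RR,
    0 <= u -> 0 <= v -> u <= v -> u `^ t <= v `^ t.
  by move=> t0 u v u0 v0; apply: gt0_ler_poweR; rewrite ?in_itv/= ?u0 ?v0 ?leey.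
apply/idP/idP => xy.
  rewrite -(poweRe1 x0) -(mulfV (lt0r_neq0 r0)) poweRrM.
  by apply: homo xy; rewrite ?invr_ge0 ?(ltW r0) ?poweR_ge0.
rewrite -(poweRe1 y0) -(mulVf (lt0r_neq0 r0)) poweRrM.
by apply: homo xy; rewrite ?(ltW r0) ?poweR_ge0.
Qed.

(** The same covers serve for both metrics: a non-empty piece satisfies diam'(E)^(1+e) <= C diam(E),
    and raising this to the power s costs the constant factor C^s in the sum. *)
Lemma hausdorff_measure_holder (d d' : T -> T -> RR) e C s X :
  (forall x y, (0 <= d x y)%R) -> (forall x y, (0 <= d' x y)%R) ->
  (0 <= e)%R -> (0 < C)%R ->
  (forall x y, (d' x y `^ (1 + e) <= C * d x y)%R) ->
  (0 <= s)%R -> hausdorff_measure d s X = 0 ->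
  hausdorff_measure d' ((1 + e) * s)%R X = 0.
Proof.
move=> d0 d'0 e0 C0 dd' s0 /hausdorff_measure_eq0 HX.
have e1 : (0 < 1 + e)%R by rewrite ltr_pwDl.
have diam E : E != set0 -> diameter d' E `^ (1 + e) <= C%:E * diameter d E.
  move=> E0; have CE : 0 <= C%:E * diameter d E.
    by rewrite mule_ge0 ?lee_fin ?(ltW C0)// diameter_ge0.
  rewrite lee_poweRl ?diameter_ge0//; apply: ge_ereal_sup => _ [x Ex [y Ey <-]].
  rewrite -lee_poweRl ?lee_fin// poweR_EFin.
  apply: (@le_trans _ _ (C * d x y)%:E); first by rewrite lee_fin.
  rewrite EFinM lee_wpmul2l ?lee_fin ?(ltW C0)//.
  by apply: ereal_sup_ubound; exists x => //; exists y.
apply/hausdorff_measure_eq0 => delta eps delta0 eps0.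
(* The mesh and the error are scaled so that the factors C and C^s cancel below. *)
have [||E [XE Ed Ee]] := HX (C^-1 * delta `^ (1 + e))%R (C `^ (- s) * eps)%R.
- by rewrite mulr_gt0 ?invr_gt0 ?powR_gt0.
- by rewrite mulr_gt0 ?powR_gt0.
exists E; split => // [i|].
  (* The empty set has diameter -oo and is settled apart; the power estimate needs a non-negative
     diameter. *)
  have [->|E0] := eqVneq (E i) set0.
    by apply: ge_ereal_sup => _ [x []].
  rewrite -(poweRe1 (ltW _ : 0 <= delta%:E)) ?lte_fin// -(mulfV (lt0r_neq0 e1)) poweRrM.
  rewrite -lee_poweRl ?poweR_ge0 ?diameter_ge0//; apply: (le_trans (diam _ E0)).
  apply: (@le_trans _ _ (C%:E * (C^-1 * delta `^ (1 + e))%:E)).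
    by rewrite lee_wpmul2l// lee_fin ltW.
  by rewrite -EFinM mulrA mulfV ?gt_eqF// mul1r poweR_EFin.
apply: (@le_lt_trans _ _ (\sum_(0 <= i <oo) ((C `^ s)%:E * diameter_pow d s (E i)))).
  apply: lee_nneseries => i _; first by move=> _; exact: diameter_pow_ge0.
  rewrite /diameter_pow; case: ifPn => E0; first by rewrite mule0.
  rewrite poweRrM -poweR_EFin -poweRM ?lee_fin ?(ltW C0) ?diameter_ge0//.
  apply: gt0_ler_poweR; rewrite ?in_itv/= ?andbT ?leey ?poweR_ge0//; last exact: diam.
  by rewrite mule_ge0 ?lee_fin ?(ltW C0) ?diameter_ge0.
rewrite nneseriesZl; last by move=> i _; exact: diameter_pow_ge0.
have -> : eps%:E = (C `^ s)%:E * (C `^ (- s) * eps)%:E.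
  by rewrite -EFinM mulrA powRN mulfV ?mul1r// gt_eqF// powR_gt0.
by rewrite lte_pmul2l ?lte_fin ?powR_gt0.
Qed.

Lemma hausdorff_dim_holder (d d' : T -> T -> RR) X :
  (forall x y, (0 <= d x y)%R) -> (forall x y, (0 <= d' x y)%R) ->
  (forall e, (0 < e)%R -> exists2 C, (0 < C)%R &
    forall x y, (d' x y `^ (1 + e) <= C * d x y)%R) ->
  hausdorff_dim d' X <= hausdorff_dim d X.
Proof.
move=> d0 d'0 dd'; apply: le_ereal_inf_tmp => _ [s /= [s0 Xs] <-].
apply/lee_addgt0Pr => e e0.
have s1 : (0 < s + 1)%R by rewrite ltr_wpDl.
(* With this choice the new exponent exceeds s by e s / (s + 1), which is at most e; the denominator
   s + 1 also serves s = 0. *)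
have [|C C0 dC] := dd' (e / (s + 1))%R; first by rewrite divr_gt0.
apply: (@le_trans _ _ ((1 + e / (s + 1)) * s)%:E).
  apply: ereal_inf_lbound; exists ((1 + e / (s + 1)) * s)%R => //=; split.
    by rewrite mulr_ge0// addr_ge0// divr_ge0// ltW.
  by apply: (hausdorff_measure_holder d0 d'0 _ C0) => //; rewrite divr_ge0 ?ltW.
rewrite -EFinD lee_fin mulrDl mul1r lerD2l -mulrA ler_piMr ?(ltW e0)//.
by rewrite mulrC ler_pdivrMr// mul1r lerDl.
Qed.

End HolderComparison.

(** * Ideals and their powers *)

Section IdealPowers.
Variable R : comNzRingType.
Implicit Types (I D : set R) (x y : R) (n k : nat).

Lemma is_ideal_smallest D : is_ideal (smallest (@is_ideal R) D).
Proof.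
split=> [I [[]]//|x y Ix Iy I ID|a x Ix I ID].
- by have [[_ ID' _] _] := ID; apply: ID'; [exact: Ix|exact: Iy].
- by have [[_ _ ID'] _] := ID; apply: ID'; exact: Ix.
Qed.

Lemma is_ideal_exp I n : is_ideal (ideal_exp I n).
Proof. by case: n => [|n]; [split|exact: is_ideal_smallest]. Qed.

Lemma ideal0 I : is_ideal I -> I 0. Proof. by case. Qed.
Lemma idealD I x y : is_ideal I -> I x -> I y -> I (x + y).
Proof. by case=> _ + _; apply. Qed.
Lemma idealMl I a x : is_ideal I -> I x -> I (a * x).
Proof. by case=> _ _; apply. Qed.
Lemma idealMr I a x : is_ideal I -> I x -> I (x * a).
Proof. by rewrite mulrC; exact: idealMl. Qed.
Lemma idealN I x : is_ideal I -> I x -> I (- x).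
Proof. by move=> II Ix; rewrite -mulN1r; exact: idealMl. Qed.
Lemma idealB I x y : is_ideal I -> I x -> I y -> I (x - y).
Proof. by move=> II Ix Iy; apply: idealD => //; exact: idealN. Qed.
Lemma ideal_expSM I n x y : I x -> ideal_exp I n y -> ideal_exp I n.+1 (x * y).
Proof. by move=> Ix Iy J [_]; apply; exists x => //; exists y. Qed.

Lemma ideal_exp_sub I n : ideal_exp I n.+1 `<=` ideal_exp I n.
Proof.
apply: smallest_sub; first exact: is_ideal_exp.
by move=> _ [x Ix [y Iy <-]]; apply: idealMl => //; exact: is_ideal_exp.
Qed.

Lemma ideal_exp_le I n k : (n <= k)%N -> ideal_exp I k `<=` ideal_exp I n.
Proof.
move=> /subnK <-; elim: (k - n)%N => [//|j IH] x Ix; apply: IH.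
exact: ideal_exp_sub.
Qed.

Lemma ideal_expM I n k x y :
  ideal_exp I n x -> ideal_exp I k y -> ideal_exp I (n + k) (x * y).
Proof.
move=> + Iy; elim: n x => [x _|n IH]; first exact: idealMl (is_ideal_exp _ _) Iy.
(* For fixed y the elements on the right form an ideal, so only the generators of the power need
   checking. *)
suff : ideal_exp I n.+1 `<=` [set x | ideal_exp I (n.+1 + k) (x * y)] by [].
have II := is_ideal_exp I (n.+1 + k); apply: smallest_sub.
  split=> [|u v Iu Iv|a u Iu] /=; rewrite ?mul0r ?mulrDl -?mulrA.
  - exact: (ideal0 II).
  - exact: (idealD II Iu Iv).
  - exact: (idealMl a II Iu).
move=> _ [u Iu [v Iv <-]] ; rewrite /mkset -mulrA.
by apply: (ideal_expSM Iu); exact: IH.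
Qed.

End IdealPowers.

(** * The absolute value of the fraction field *)

Section AdicAbs.
Variables (RR : realType) (c : RR) (R : idomainType) (m : set R).
Hypothesis c_gt1 : 1 < c.
Hypothesis m_sep : \bigcap_n ideal_exp m n = [set 0].
Hypothesis grR : gr_integral_domain m.
Implicit Types x y : R.

Let c_gt0 : 0 < c := lt_trans ltr01 c_gt1.

(** Separatedness puts a nonzero x outside some power of m, so there is a last power containing x,
    and [xget] does not fall back on its default. *)
Lemma adic_orderP x n : x != 0 -> ideal_exp m n x <-> (n <= adic_order m x)%N.
Proof.
move=> x0; have [k kx] : exists k, ~ ideal_exp m k x.
  apply/not_existsP => mx; have : (\bigcap_n ideal_exp m n) x.
    by move=> k _; have := mx k; rewrite notK.
  by rewrite m_sep => /= /eqP; rewrite (negbTE x0).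
have [h [hx1 hx2]] : exists h, ideal_exp m h x /\ ~ ideal_exp m h.+1 x.
  elim: k kx => [[]//|k IH kx].
  by have [|/IH//] := pselect (ideal_exp m k x); exists k.
have := @xgetPex _ 0%N [set n | ideal_exp m n x /\ ~ ideal_exp m n.+1 x]
  (ex_intro _ h (conj hx1 hx2)).
rewrite -/(adic_order m x) => -[ox1 ox2]; split=> [nx|nx].
  by rewrite leqNgt; apply/negP => /ideal_exp_le/(_ _ nx).
exact: ideal_exp_le ox1.
Qed.

(** The initial forms of x and y, represented in the Rees ring by x X^i and y X^j, are nonzero in
    the graded ring; if xy lay in m^(i+j+1), their product would vanish there. *)
Lemma adic_orderM x y : x != 0 -> y != 0 ->
  adic_order m (x * y) = (adic_order m x + adic_order m y)%N.
Proof.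
move=> x0 y0; have xy0 : x * y != 0 by rewrite mulf_neq0.
set i := adic_order m x; set j := adic_order m y.
apply/eqP; rewrite eqn_leq; apply/andP; split; last first.
  by apply/adic_orderP => //; apply: ideal_expM; apply/adic_orderP.
rewrite leqNgt; apply/negP => /(adic_orderP _ xy0) xyI.
have gr k (z : R) : ideal_exp m k z -> rees_mem m (z *: 'X^k).
  move=> kz n; rewrite coefZ coefXn; case: eqP => [->|_]; first by rewrite mulr1.
  by rewrite mulr0; exact: ideal0 (is_ideal_exp _ _).
have [_ /(_ (x *: 'X^i) (y *: 'X^j))] := grR.
case; [by apply: gr; exact/adic_orderP|by apply: gr; exact/adic_orderP| | |].
- move=> n; rewrite -scalerAl -scalerAr -exprD scalerA coefZ coefXn.
  case: eqP => [->|_]; first by rewrite mulr1.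
  by rewrite mulr0; exact: ideal0 (is_ideal_exp _ _).
- move=> /(_ i); rewrite coefZ coefXn eqxx mulr1 => /(adic_orderP _ x0).
  by rewrite ltnn.
- move=> /(_ j); rewrite coefZ coefXn eqxx mulr1 => /(adic_orderP _ y0).
  by rewrite ltnn.
Qed.

Lemma adic_abs_ge0 x : 0 <= adic_abs c m x.
Proof. by rewrite /adic_abs; case: ifP => // _; rewrite invr_ge0 exprn_ge0 ?ltW. Qed.

Lemma adic_abs_eq0 x : (adic_abs c m x == 0) = (x == 0).
Proof.
rewrite /adic_abs; case: (eqVneq x 0) => [_|x0]; first exact: eqxx.
by apply/negbTE; rewrite invr_eq0 expf_eq0 (gt_eqF c_gt0) andbF.
Qed.

Lemma adic_absM x y : adic_abs c m (x * y) = adic_abs c m x * adic_abs c m y.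
Proof.
rewrite /adic_abs mulf_eq0; case: eqVneq => [|x0] /=; first by rewrite mul0r.
case: eqVneq => [|y0] /=; first by rewrite mulr0.
by rewrite adic_orderM// exprD invfM mulrC.
Qed.

Lemma adic_abs_le x n : (adic_abs c m x <= c ^- n) <-> ideal_exp m n x.
Proof.
rewrite /adic_abs; case: eqVneq => [->|x0].
  split=> _; first exact: ideal0 (is_ideal_exp _ _).
  by rewrite invr_ge0 exprn_ge0 ?ltW.
rewrite lef_pV2 ?posrE ?exprn_gt0// ler_eXn2l//.
by split=> /(adic_orderP _ x0).
Qed.

Lemma adic_absD x y :
  adic_abs c m (x + y) <= Num.max (adic_abs c m x) (adic_abs c m y).
Proof.
have main u v : adic_abs c m u <= adic_abs c m v ->
    adic_abs c m (u + v) <= adic_abs c m v.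
  have [->|v0] := eqVneq v 0; first by rewrite addr0.
  have -> : adic_abs c m v = c ^- adic_order m v by rewrite /adic_abs (negbTE v0).
  move=> /adic_abs_le ui; apply/adic_abs_le.
  by apply: idealD => //; [exact: is_ideal_exp|exact/adic_orderP].
rewrite le_max; have [xy|/ltW yx] := leP (adic_abs c m x) (adic_abs c m y).
  by rewrite main ?orbT.
by rewrite addrC main.
Qed.

Lemma adic_absN x : adic_abs c m (- x) = adic_abs c m x.
Proof.
have : adic_abs c m (-1) = 1.
  apply/eqP; rewrite -[_ == 1](@eqrXn2 _ 2)// ?adic_abs_ge0//.
  rewrite expr1n expr2 -adic_absM mulrNN mulr1.
  rewrite -(inj_eq (mulfI (_ : adic_abs c m 1 != 0))) ?adic_abs_eq0 ?oner_eq0//.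
  by rewrite -adic_absM !mulr1.
by move=> h; rewrite -mulN1r adic_absM h mul1r.
Qed.

Local Notation K := {fraction R}.
Local Notation "x %:F" := (@tofrac R x).
Implicit Types z w : K.

Lemma frac_reprE z :
  z = ((frac (repr z)).1)%:F / ((frac (repr z)).2)%:F.
Proof.
have piE (r : {ratio R}) : \pi_K%qT r * (frac r).2%:F = (frac r).1%:F.
  unlock FracField.tofrac; rewrite -[LHS]FracField.pi_mul; apply/eqmodP => /=.
  rewrite FracField.equivfE /FracField.mulf !numden_Ratio ?mulf_neq0 ?oner_eq0 ?denom_ratioP//.
  by rewrite !mulr1 mulrC.
have d0 : (frac (repr z)).2%:F != 0 by rewrite tofrac_eq0 denom_ratioP.
by apply: (mulIf d0); rewrite mulfVK// -[in LHS](reprK z) -piE reprK.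
Qed.

(** Frees [frac_abs] from the representative chosen in its definition: two fractions for the same
    element are cross-multiplied, and [adic_abs] is multiplicative. *)
Lemma frac_abs_div x y : y != 0 ->
  frac_abs c m (x%:F / y%:F) = adic_abs c m x / adic_abs c m y.
Proof.
move=> y0; set z := _ / _; rewrite /frac_abs.
have d0 := denom_ratioP (repr z).
apply/eqP; rewrite eqr_div ?adic_abs_eq0// -!adic_absM; apply/eqP; congr adic_abs.
apply/eqP; rewrite -tofrac_eq !tofracM.
have /eqP := frac_reprE z; rewrite {1}/z eqr_div ?tofrac_eq0//.
by rewrite eq_sym.
Qed.

Lemma frac_elim z : exists x y, y != 0 /\ z = x%:F / y%:F.
Proof.
exists (frac (repr z)).1, (frac (repr z)).2; split; first exact: denom_ratioP.
exact: frac_reprE.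
Qed.

Lemma frac_abs_tofrac x : frac_abs c m (x%:F) = adic_abs c m x.
Proof.
have h : adic_abs c m 1 != 0 by rewrite adic_abs_eq0 oner_eq0.
have := frac_abs_div x (oner_neq0 R); rewrite tofrac1 divr1 => ->.
by apply: (mulIf h); rewrite mulfVK// -adic_absM mulr1.
Qed.

Lemma frac_abs_ge0 z : 0 <= frac_abs c m z.
Proof. by rewrite divr_ge0// adic_abs_ge0. Qed.

Lemma frac_absM z w : frac_abs c m (z * w) = frac_abs c m z * frac_abs c m w.
Proof.
have [x [y [y0 ->]]] := frac_elim z; have [u [v [v0 ->]]] := frac_elim w.
rewrite mulf_div -!tofracM !frac_abs_div ?mulf_neq0// !adic_absM.
by rewrite mulf_div.
Qed.

Lemma frac_absD z w :
  frac_abs c m (z + w) <= Num.max (frac_abs c m z) (frac_abs c m w).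
Proof.
have [x [y [y0 ->]]] := frac_elim z; have [u [v [v0 ->]]] := frac_elim w.
rewrite addf_div ?tofrac_eq0// -!tofracM -tofracD.
have -> : x%:F / y%:F = (x * v)%:F / (y * v)%:F.
  by rewrite !tofracM -mulf_div divff ?mulr1// tofrac_eq0.
have -> : u%:F / v%:F = (u * y)%:F / (y * v)%:F.
  by rewrite !tofracM [_%:F * _%:F]mulrC -mulf_div divff ?mul1r// tofrac_eq0.
rewrite !frac_abs_div ?mulf_neq0//.
rewrite -maxr_pMl ?invr_ge0 ?adic_abs_ge0//.
by rewrite ler_wpM2r ?invr_ge0 ?adic_abs_ge0// adic_absD.
Qed.

Lemma frac_absN z : frac_abs c m (- z) = frac_abs c m z.
Proof.
have [x [y [y0 ->]]] := frac_elim z.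
by rewrite -mulNr -tofracN !frac_abs_div// adic_absN.
Qed.

Lemma frac_abs_sum (I : Type) (r : seq I) (P : pred I) (f : I -> K) B :
  0 <= B -> (forall i, P i -> frac_abs c m (f i) <= B) ->
  frac_abs c m (\sum_(i <- r | P i) f i) <= B.
Proof.
move=> B0 fB; elim/big_rec: _ => [|i x Pi xB].
  by rewrite -tofrac0 frac_abs_tofrac /adic_abs eqxx.
by apply: le_trans (frac_absD _ _) _; rewrite ge_max fB.
Qed.

Lemma frac_absX z n : frac_abs c m (z ^+ n) = frac_abs c m z ^+ n.
Proof.
have h : frac_abs c m 1 = 1.
  apply: (mulfI (_ : frac_abs c m 1 != 0)).
    by rewrite -tofrac1 frac_abs_tofrac adic_abs_eq0 oner_eq0.
  by rewrite -frac_absM !mulr1.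
by elim: n => [|n IH]; rewrite ?expr0// !exprS frac_absM IH.
Qed.

End AdicAbs.

(** * Power series *)

Section PowerSeries.
Variables (RR : realType) (c : RR) (R : idomainType) (m : set R).
Hypothesis c_gt1 : 1 < c.
Hypothesis m_sep : \bigcap_n ideal_exp m n = [set 0].
Hypothesis grR : gr_integral_domain m.

Let c_gt0 : 0 < c := lt_trans ltr01 c_gt1.
Local Notation K := {fraction R}.
Local Notation "x %:F" := (@tofrac R x).
Local Notation val := (frac_abs c m).

Lemma frac_abs0 : val 0 = 0.
Proof. by rewrite -tofrac0 frac_abs_tofrac// /adic_abs eqxx. Qed.

Lemma frac_abs_prod (I : Type) (s : seq I) (P : pred I) (f : I -> K) :
  val (\prod_(i <- s | P i) f i) = \prod_(i <- s | P i) val (f i).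
Proof.
apply: (big_morph _ (frac_absM c_gt1 m_sep grR)).
by rewrite -(expr0 0) frac_absX// expr0.
Qed.

(** No passage to a limit is required: if B < |l - l'|, then |l - l'| itself is taken as the error,
    and on a common finite set of indices the ultrametric inequality gives |l - l'| < |l - l'|. *)
Lemma series_sum_at_congr r (F : power_series r K) (z z' : 'rV[K]_r) (l l' : K)
    B : 0 <= B ->
  series_sum_at c m F z l -> series_sum_at c m F z' l' ->
  (forall a, val (F a * (monomial_at z a - monomial_at z' a)) <= B) ->
  val (l - l') <= B.
Proof.
move=> B0 Fl Fl' FB; rewrite leNgt; apply/negP => Bl.
have e0 := le_lt_trans B0 Bl.
have [A1 HA1] := Fl _ e0; have [A2 HA2] := Fl' _ e0.
have := HA1 (A1 `|` A2)%fset (fsubsetUl _ _).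
have := HA2 (A1 `|` A2)%fset (fsubsetUr _ _).
set A := (A1 `|` A2)%fset; set s := bigop _ _ _; set s' := bigop _ _ _ => sl s'l.
have ss : val (s' - s) <= B.
  rewrite -sumrB (eq_bigr _ (fun a _ => esym (mulrBr (F a) _ _))).
  exact: frac_abs_sum.
have : val (l - l') < val (l - l').
  have -> : l - l' = (s' - s) + (s - l') + - (s' - l) by ring.
  apply: le_lt_trans (frac_absD c_gt1 m_sep grR _ _) _; rewrite gt_max frac_absN//.
  rewrite {2}(_ : s' - s + _ - _ = l - l') ?s'l ?andbT; last by ring.
  apply: le_lt_trans (frac_absD c_gt1 m_sep grR _ _) _; rewrite gt_max.
  by rewrite (_ : s' - s + _ - _ = l - l') ?(le_lt_trans ss)//; ring.
by rewrite ltxx.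
Qed.

(** A term outside the finite set A is the difference of two partial sums, each within 1 of l; the
    terms inside A are bounded by the sum of their absolute values. *)
Lemma series_sum_at_bounded r (F : power_series r K) (z : 'rV[K]_r) (l : K) :
  series_sum_at c m F z l -> exists B, forall a, val (F a * monomial_at z a) <= B.
Proof.
move=> /(_ 1 ltr01)[A HA]; pose B := \sum_(a <- A) val (F a * monomial_at z a).
have B0 : 0 <= B by apply: sumr_ge0 => a _; exact: frac_abs_ge0.
exists (1 + B) => a; have [aA|aA] := boolP (a \in A).
  rewrite /B (big_fsetD1 a)//= addrCA lerDl addr_ge0//.
  by apply: sumr_ge0 => ? _; exact: frac_abs_ge0.
have := HA (a |` A)%fset (fsubsetUr _ _); rewrite big_fsetU1//= => aAl.
have Al := HA A (fsubset_refl _).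
set t := _ * _ in aAl *; set s := bigop _ _ _ in aAl Al.
have -> : t = (t + s - l) + - (s - l) by ring.
apply: le_trans (frac_absD c_gt1 m_sep grR _ _) _; rewrite ge_max frac_absN//.
have B1 : 1 <= 1 + B by rewrite lerDl.
by rewrite (le_trans (ltW aAl) B1) (le_trans (ltW Al) B1).
Qed.

Lemma ubound_expr (B : RR) : exists b, B <= c ^+ b.
Proof.
have bern n : 1 + n%:R * (c - 1) <= c ^+ n.
  elim: n => [|n IH]; first by rewrite mul0r addr0.
  rewrite exprSr; apply: le_trans (ler_wpM2r (ltW c_gt0) IH).
  have : 0 <= n%:R * (c - 1) ^+ 2 by rewrite mulr_ge0 ?sqr_ge0.
  by rewrite -natr1; nra.
have c1 : 0 < c - 1 by rewrite subr_gt0.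
exists (Num.bound `|B / (c - 1)|); apply: le_trans (bern _).
apply: (@le_trans _ _ ((Num.bound `|B / (c - 1)|)%:R * (c - 1))); last by rewrite lerDr.
rewrite -ler_pdivrMr//; apply: le_trans (ler_norm _) _.
exact/ltW/archi_boundP/normr_ge0.
Qed.

(* Evaluating the series at (p, ..., p) with p != 0 in m^l bounds F_a p^|a| by a
   constant B; for |x| <= |p| every nonconstant term is then at most B |x| / |p|. *)
Lemma analytic_lipschitz r (F : power_series r K) (l : nat)
    (g : 'rV[R]_r -> R) :
  (forall x, vec_in (ideal_exp m l) x ->
    series_sum_at c m F (map_mx (@tofrac R) x) (g x)%:F) ->
  exists k, (l <= k)%N /\ forall n x, vec_in (ideal_exp m (n + k)) x ->
    ideal_exp m n (g x - g 0).
Proof.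
move=> Fg; have v0 j : vec_in (ideal_exp m j) (0 : 'rV[R]_r).
  by move=> i; rewrite mxE; exact: ideal0 (is_ideal_exp _ _).
(* If there is no such p, then m^l is zero and x = 0 is the only point to consider. *)
have [[p [lp p0]]|lp] := pselect (exists p, ideal_exp m l p /\ p != 0); last first.
  exists l; split=> // n x nx; suff -> : x = 0 by rewrite subrr; exact: ideal0 (is_ideal_exp _ _).
  apply/rowP => i; rewrite mxE; apply/eqP/negPn/negP => xi0; apply: lp.
  by exists (x 0 i); split => //; exact: ideal_exp_le (leq_addl _ _) _ (nx i).
have [B FB] : exists B, forall a, val (F a * monomial_at (const_mx p%:F) a) <= B.
  have := Fg (const_mx p); rewrite map_const_mx => Fp.
  by apply: series_sum_at_bounded (Fp _) => i; rewrite mxE.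
have [b Bb] := ubound_expr B.
have vp : val p%:F = c ^- adic_order m p.
  by rewrite frac_abs_tofrac// /adic_abs (negbTE p0).
set o := adic_order m p in vp; have lo : (l <= o)%N by apply/adic_orderP.
(* Here |p| = c^-o and B <= c^b: the coordinates of a point of m^(n+o+b) are at most |p| c^-(n+b),
   and B c^-(n+b) <= c^-n. *)
exists (o + b)%N; split; first by rewrite (leq_trans lo)// leq_addr.
move=> n x nx; apply/(adic_abs_le c_gt1 m_sep).
rewrite -(frac_abs_tofrac c_gt1 m_sep grR) tofracB.
have lx : vec_in (ideal_exp m l) x.
  move=> i; apply: ideal_exp_le (nx i).
  by rewrite (leq_trans lo)// addnCA leq_addr.
apply: (series_sum_at_congr _ (Fg _ lx) (Fg _ (v0 l))).
  by rewrite invr_ge0 exprn_ge0 ?ltW.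
move=> a; have [/forallP a0|] := boolP [forall j, a j == 0%N].
  rewrite /monomial_at !big1 ?subrr ?mulr0 ?frac_abs0 ?invr_ge0 ?exprn_ge0 ?ltW//.
  - by move=> i _; rewrite (eqP (a0 i)).
  - by move=> i _; rewrite (eqP (a0 i)).
rewrite negb_forall => /existsP[j aj].
have -> : monomial_at (map_mx (@tofrac R) 0) a = 0.
  by rewrite /monomial_at (bigD1 j)//= !mxE tofrac0 expr0n (negbTE aj) mul0r.
rewrite subr0 frac_absM//; set t := c ^- (n + b).
have t0 : 0 <= t by rewrite invr_ge0 exprn_ge0 ?ltW.
have t1 : t <= 1 by rewrite invf_le1 ?exprn_gt0// exprn_ege1// ltW.
have vpt0 : 0 <= val p%:F * t by apply: mulr_ge0 => //; exact: frac_abs_ge0.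
have xt : val (monomial_at (map_mx (@tofrac R) x) a) <=
    val (monomial_at (const_mx p%:F) a) * t.
  rewrite /monomial_at !frac_abs_prod.
  apply: (@le_trans _ _ (\prod_j (val p%:F * t) ^+ a j)).
    apply: ler_prod => i _; rewrite frac_abs_ge0//= frac_absX// !mxE.
    apply: lerXn2r; rewrite ?nnegrE ?frac_abs_ge0// ?vpt0//.
    rewrite vp -invfM -exprD frac_abs_tofrac//; apply/(adic_abs_le c_gt1 m_sep).
    by rewrite addnCA; exact: nx.
  rewrite (eq_bigr _ (fun i _ => exprMn _ _ _)) big_split/=.
  rewrite (eq_bigr (fun i => val ((const_mx p%:F : 'rV[K]_r) 0 i ^+ a i))); last first.
    by move=> i _; rewrite frac_absX// mxE.
  apply: ler_wpM2l; first by apply: prodr_ge0 => i _; exact: frac_abs_ge0.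
  (* The total degree of a is at least 1 because a j is nonzero, and t <= 1, so one factor t can be
     kept and the others dropped. *)
  rewrite prodrXr (bigD1 j)//= -[leRHS]expr1.
  by apply: ler_wiXn2l; rewrite // addn_gt0 lt0n aj.
apply: (@le_trans _ _ (B * t)).
  apply: (@le_trans _ _ (val (F a) * (val (monomial_at (const_mx p%:F) a) * t))).
    by apply: ler_wpM2l => //; exact: frac_abs_ge0.
  by rewrite mulrA -frac_absM// ler_wpM2r.
rewrite /t exprD invfM mulrA mulrAC ler_piMl ?invr_ge0 ?exprn_ge0 ?(ltW c_gt0)//.
by rewrite ler_pdivrMr ?exprn_gt0// mul1r.
Qed.

(** Differences of monomials stay in m^n, and so do their multiples by coefficients from R: in
    contrast to series over K, no power of m is lost. *)
Lemma integral_series_congr r (F : power_series r R) (x y : 'rV[R]_r) (u v : R) n :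
  series_sum_at c m (fun a => (F a)%:F) (map_mx (@tofrac R) x) u%:F ->
  series_sum_at c m (fun a => (F a)%:F) (map_mx (@tofrac R) y) v%:F ->
  vec_in (ideal_exp m n) (x - y) -> ideal_exp m n (u - v).
Proof.
move=> Fx Fy xy; apply/(adic_abs_le c_gt1 m_sep).
rewrite -(frac_abs_tofrac c_gt1 m_sep grR) tofracB.
apply: (series_sum_at_congr _ Fx Fy); first by rewrite invr_ge0 exprn_ge0 ?ltW.
move=> a; have monE (z : 'rV[R]_r) : monomial_at (map_mx (@tofrac R) z) a =
    (\prod_j z 0 j ^+ a j)%:F.
  by rewrite /monomial_at rmorph_prod; apply: eq_bigr => j _; rewrite rmorphXn mxE.
rewrite !monE -tofracB -tofracM frac_abs_tofrac//; apply/adic_abs_le => //.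
have II := is_ideal_exp m n; apply: (idealMl _ II).
have XI k (s t : R) : ideal_exp m n (s - t) -> ideal_exp m n (s ^+ k - t ^+ k).
  by move=> st; rewrite subrXX; exact: idealMr.
suff : forall rs : seq 'I_r, ideal_exp m n
  (\prod_(j <- rs) x 0 j ^+ a j - \prod_(j <- rs) y 0 j ^+ a j) by apply.
elim=> [|j rs IH]; first by rewrite !big_nil subrr; exact: ideal0.
rewrite !big_cons; set s := x 0 j ^+ _; set t := y 0 j ^+ _.
set X := bigop _ _ _; set Y := bigop _ _ _.
have -> : s * X - t * Y = (s - t) * X + t * (X - Y) by ring.
apply: (idealD II); last exact: (idealMl _ II).
by apply: (idealMr _ II); apply: XI; have := xy j; rewrite !mxE.
Qed.

End PowerSeries.

(** * Indices *)

Section ClassNumber.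
Variable T : Type.
Implicit Types (X : set T) (E : T -> T -> Prop) (k : nat).

(** A complete system of k representatives. The relation is left arbitrary so that one notion serves
    for ideals, for vectors and for cosets. *)
Definition class_number X E k := exists f : 'I_k -> T,
  [/\ forall i, X (f i), forall i j, E (f i) (f j) -> i = j &
      forall x, X x -> exists i, E x (f i)].

Lemma class_number_finType X E (J : finType) (f : J -> T) :
  (forall i, X (f i)) -> (forall i j, E (f i) (f j) -> i = j) ->
  (forall x, X x -> exists i, E x (f i)) -> class_number X E #|J|.
Proof.
move=> fX fE fS; exists (fun i => f (enum_val i)); split => [//|i j /fE|x /fS[i xi]].
  exact: enum_val_inj.
by exists (enum_rank i); rewrite enum_rankK.
Qed.

Lemma class_number_le X E k l :
  (forall x y, E x y -> E y x) -> (forall x y z, E x y -> E y z -> E x z) ->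
  class_number X E k -> class_number X E l -> (k <= l)%N.
Proof.
move=> Es Et [f [fX fE fS]] [g [gX gE gS]].
have /choice[h hE] i : exists j, E (f i) (g j) by exact: gS (fX i).
have hI : injective h.
  move=> i j hij; apply: fE; apply: Et (hE i) _; apply: Es; rewrite hij; exact: hE.
by have := leq_card h hI; rewrite !card_ord.
Qed.

Lemma class_number_uniq X E k l :
  (forall x y, E x y -> E y x) -> (forall x y z, E x y -> E y z -> E x z) ->
  class_number X E k -> class_number X E l -> k = l.
Proof.
move=> Es Et Xk Xl; apply/eqP; rewrite eqn_leq.
by rewrite !(class_number_le (X := X) Es Et).
Qed.

(** In a covering family of minimal length no class occurs twice, since [lift] would skip the
    repetition. *)
Lemma class_number_cover E n (f : 'I_n -> T) :
  (forall x y, E x y -> E y x) -> (forall x y z, E x y -> E y z -> E x z) ->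
  (forall x, exists i, E x (f i)) -> exists k, class_number setT E k.
Proof.
move=> Es Et fS.
pose P k := `[< exists f : 'I_k -> T, forall x, exists i, E x (f i) >].
have exP : exists k, P k by exists n; apply/asboolP; exists f.
case: (ex_minnP exP) => k /asboolP[g gS] kmin.
exists k, g; split => // i j gij; apply: contrapT => /eqP ij.
case: k g gS kmin i j gij ij => [|k] g gS kmin i j gij ij; first by case: i ij gij.
have : P k; last by move=> /kmin; rewrite ltnn.
apply/asboolP; exists (g \o lift j) => x; have [l xl] := gS x.
case: (unliftP j l) xl => [l' -> xl|-> xj]; first by exists l'.
case: (unliftP j i) => [i' ii'|ji]; last by rewrite ji eqxx in ij.
by exists i'; apply: Et xj _; rewrite /= -ii'; exact: Es.
Qed.

End ClassNumber.

Section IdealIndex.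
Variable R : comNzRingType.
Implicit Types I J L : set R.

Definition ideal_index I J k := class_number I (fun x y => J (x - y)) k.

Lemma ideal_congr_sym J : is_ideal J -> forall x y, J (x - y) -> J (y - x).
Proof. by move=> iJ x y xy; rewrite -opprB; exact: idealN. Qed.

Lemma ideal_congr_trans J : is_ideal J ->
  forall x y z, J (x - y) -> J (y - z) -> J (x - z).
Proof. by move=> iJ x y z xy yz; rewrite -(subrK y x) -addrA; exact: idealD. Qed.

Lemma ideal_index_uniq I J k l : is_ideal J ->
  ideal_index I J k -> ideal_index I J l -> k = l.
Proof.
by move=> iJ; apply: class_number_uniq; [exact: ideal_congr_sym|exact: ideal_congr_trans].
Qed.

Lemma ideal_index_gt0 I J k : is_ideal I -> ideal_index I J k -> (0 < k)%N.
Proof. by move=> iI [f [_ _ /(_ 0 (ideal0 iI))[[]]]]; case: k f. Qed.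

Lemma ideal_indexM I J L a b : is_ideal I -> is_ideal J -> is_ideal L ->
  L `<=` J -> J `<=` I ->
  ideal_index I J a -> ideal_index J L b -> ideal_index I L (a * b).
Proof.
move=> iI iJ iL LJ JI [f [fI fE fS]] [g [gJ gE gS]].
have -> : (a * b)%N = #|{: 'I_a * 'I_b}| by rewrite card_prod !card_ord.
apply: (class_number_finType (f := fun p => f p.1 + g p.2)) => [[i j]|[i j] [i' j']|x] /=.
- by apply: (idealD iI) => //; exact: JI.
- move=> Lfg; have Jfg := LJ _ Lfg.
  have ii : i = i'.
    apply: fE; have -> : f i - f i' = (f i + g j - (f i' + g j')) + (g j' - g j) by ring.
    by apply: (idealD iJ) => //; exact: (idealB iJ).
  subst i'; congr (_, _); apply: gE.
  by have -> : g j - g j' = f i + g j - (f i + g j') by ring.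
- move=> /fS[i xi]; have [j xij] := gS _ xi.
  by exists (i, j) => /=; rewrite opprD addrA.
Qed.

Lemma ideal_index1 I : is_ideal I -> ideal_index I I 1.
Proof.
move=> iI; exists (fun=> 0); split => [i|i j _|x Ix].
- exact: ideal0.
- by rewrite [i]ord1 [j]ord1.
- by exists ord0; rewrite subr0.
Qed.

End IdealIndex.

(** * Growth of the Hilbert function *)

Section WordCodes.
Variables (s B : nat).
Implicit Types (w : seq 'I_s) (k n : nat).

(* A word w stands for the monomial x_w; when the size of w is less than B, the
   number of occurrences of i in w is the digit of weight B^i of code w. So code
   orders the monomials lexicographically, and adds under multiplication. *)
Definition digit i k := ((k %/ B ^ i) %% B)%N.
Definition code w := (\sum_(i <- w) B ^ i)%N.

(** The hypothesis on digit j excludes a carry. *)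
Lemma digit_addX i j k : ((digit j k).+1 < B)%N ->
  digit i (k + B ^ j) = (digit i k + (i == j))%N.
Proof.
move=> jB; have B0 : (0 < B)%N by case: B jB.
have BX l : (0 < B ^ l)%N by rewrite expn_gt0 B0.
rewrite /digit; case: (ltngtP i j) => ij; rewrite ?addn0.
- rewrite -(subnK (ltnW ij)) expnD divnDMl// -(subnSK ij) expnSr.
  by rewrite addnC modnMDl.
- have dj : ((k + B ^ j) %/ B ^ j.+1 = k %/ B ^ j.+1)%N.
    rewrite expnSr !divnMA -{1}(mul1n (B ^ j)%N) divnDMl// addn1.
    rewrite {1}(divn_eq (k %/ B ^ j) B) -addnS divnDl ?dvdn_mull//.
    by rewrite mulnK// (divn_small jB) addn0.
  by rewrite -(subnKC ij) expnD !divnMA dj.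
- by subst j; rewrite -{1}(mul1n (B ^ i)%N) divnDMl// -modnDml modn_small addn1.
Qed.

Lemma code_cons i w : code (i :: w) = (B ^ i + code w)%N.
Proof. by rewrite /code big_cons. Qed.

Lemma digit_code w (i : 'I_s) : (size w < B)%N -> digit i (code w) = count_mem i w.
Proof.
elim: w i => [|j w IH] i /= wB; first by rewrite /code big_nil /digit div0n mod0n.
have IH' l := IH l (ltnW wB).
rewrite code_cons addnC digit_addX ?IH'; first by rewrite addnC eq_sym.
by apply: leq_ltn_trans wB; rewrite ltnS count_size.
Qed.

Lemma code_inj w w' : (size w < B)%N -> (size w' < B)%N -> code w = code w' ->
  perm_eq w w'.
Proof.
by move=> wB w'B ww'; apply/allP => i _ /=; rewrite -!digit_code// ww'.
Qed.

Lemma perm_code w w' : perm_eq w w' -> code w = code w'.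
Proof. by move=> ww'; exact: perm_big. Qed.

(** There are fewer than B letters, each contributing at most B^s; this makes the counting of codes
    finite. *)
Lemma code_lt w : (size w < B)%N -> (code w < B ^ s.+1)%N.
Proof.
move=> wB; apply: (@leq_ltn_trans (size w * B ^ s)).
  rewrite /code -sum1_size big_distrl /= leq_sum// => i _.
  by rewrite mul1n leq_pexp2l ?(leq_trans _ wB)// ltnW.
by rewrite expnS ltn_pmul2r// expn_gt0 (leq_ltn_trans _ wB).
Qed.

End WordCodes.

Section HilbertFunction.
Variables (R : comNzRingType) (m : set R) (s : nat) (x : 'I_s -> R) (q : nat).
Hypothesis m_gen : m = smallest (@is_ideal R) (range x).
Hypothesis m_max : forall u, ~ m u -> exists a, m (1 - a * u).
Hypothesis m_index : ideal_index setT m q.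
Variable B : nat.
Implicit Types (w : seq 'I_s) (k n : nat).

Let m_ideal : is_ideal m.
Proof. by rewrite m_gen; exact: is_ideal_smallest. Qed.

Let gen_m i : m (x i).
Proof. by rewrite m_gen => I [_]; apply; exists i. Qed.

Definition word_prod w := \prod_(i <- w) x i.

(** A chain of ideals that rises from m^(n+1), at k = 0, to m^n, at k = B^(s+1) if n < B, and takes
    in the monomials of degree n in the order of their codes. *)
Definition lower_ideal n k := smallest (@is_ideal R)
  (ideal_exp m n.+1 `|` [set word_prod w | w in [set w | size w = n /\ (code B w < k)%N]]).

(* Standard monomials, as for Groebner bases: they form an order ideal
   (standard_pred). *)
Definition standard n k :=
  `[< exists w, [/\ size w = n, code B w = k & ~ lower_ideal n k (word_prod w)] >].

Lemma word_prod_exp w : ideal_exp m (size w) (word_prod w).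
Proof.
elim: w => [//|i w IH]; rewrite /word_prod big_cons.
exact: ideal_expSM (gen_m i) IH.
Qed.

(** Colon ideals reduce each factor of a product to generators, one after the other. *)
Lemma ideal_exp_words n : ideal_exp m n `<=`
  smallest (@is_ideal R) [set word_prod w | w in [set w | size w = n]].
Proof.
elim: n => [y _|n IH].
  rewrite -[y]mulr1; apply: (idealMl _ (is_ideal_smallest _)).
  by move=> I [_]; apply; exists [::] => //; rewrite /word_prod big_nil.
set J := smallest _ _; have JI : is_ideal J by exact: is_ideal_smallest.
apply: smallest_sub => // _ [a ma [b /IH nb <-]].
have colon (c : R) : is_ideal [set u | J (u * c)].
  split=> [|u v Ju Jv|d u Ju]; rewrite /mkset ?mul0r ?mulrDl -?mulrA.
  - exact: (ideal0 JI).
  - exact: (idealD JI).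
  - exact: (idealMl _ JI).
suff /(_ _ nb) : smallest (@is_ideal R) [set word_prod w | w in [set w | size w = n]]
    `<=` [set u | J (u * a)] by rewrite /mkset mulrC.
apply: smallest_sub; first exact: colon.
move=> _ [w /= wn <-]; rewrite /mkset mulrC.
suff : m `<=` [set u | J (u * word_prod w)] by apply.
rewrite m_gen; apply: smallest_sub; first exact: colon.
move=> _ [i _ <-] I [_]; apply; exists (i :: w) => /=; first by rewrite wn.
by rewrite /word_prod big_cons.
Qed.

Lemma is_ideal_lower n k : is_ideal (lower_ideal n k).
Proof. exact: is_ideal_smallest. Qed.

Lemma lower_ideal_expS n k : ideal_exp m n.+1 `<=` lower_ideal n k.
Proof. by move=> y my I [_]; apply; left. Qed.

Lemma lower_ideal_word n k w :
  size w = n -> (code B w < k)%N -> lower_ideal n k (word_prod w).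
Proof. by move=> wn wk I [_]; apply; right; exists w. Qed.

Lemma lower_ideal_sub n k : lower_ideal n k `<=` ideal_exp m n.
Proof.
apply: smallest_sub; first exact: is_ideal_exp.
move=> y [|[w [wn _] <-]]; first exact: ideal_exp_sub.
by rewrite -wn; exact: word_prod_exp.
Qed.

Lemma lower_ideal0 n : lower_ideal n 0 = ideal_exp m n.+1.
Proof.
rewrite eqEsubset; split; last exact: lower_ideal_expS.
by apply: smallest_sub; [exact: is_ideal_exp|move=> y [//|[w [_]]]].
Qed.

Lemma lower_ideal_le n k l : (k <= l)%N -> lower_ideal n k `<=` lower_ideal n l.
Proof.
move=> kl; apply: smallest_sub; first exact: is_ideal_lower.
move=> y [|[w [wn wk] <-]]; first exact: lower_ideal_expS.
by apply: lower_ideal_word => //; exact: leq_trans kl.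
Qed.

Lemma lower_ideal_max n : (n < B)%N -> lower_ideal n (B ^ s.+1) = ideal_exp m n.
Proof.
move=> nB; rewrite eqEsubset; split; first exact: lower_ideal_sub.
move=> y /ideal_exp_words; apply: smallest_sub; first exact: is_ideal_lower.
by move=> _ [w /= wn <-]; apply: lower_ideal_word => //; apply: code_lt; rewrite wn.
Qed.

(** Multiplication by x_i adds B^i to every code, so it respects the monomial order and sends lower
    monomials to lower monomials. *)
Lemma lower_ideal_cons n k w (i : 'I_s) :
  lower_ideal n k (word_prod w) ->
  lower_ideal n.+1 (k + B ^ i) (word_prod (i :: w)).
Proof.
have iL := is_ideal_lower n.+1 (k + B ^ i).
suff H : lower_ideal n k `<=` [set u | lower_ideal n.+1 (k + B ^ i) (x i * u)].
  by move=> /H; rewrite /word_prod big_cons.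
apply: smallest_sub.
  split=> [|u v Ju Jv|d u Ju]; rewrite /mkset ?mulr0 ?mulrDr 1?mulrCA.
  - exact: (ideal0 iL).
  - exact: (idealD iL).
  - exact: (idealMl _ iL).
move=> y [my|[w' [w'n w'k] <-]].
  by apply: lower_ideal_expS; exact: ideal_expSM.
rewrite /mkset; have -> : x i * word_prod w' = word_prod (i :: w').
  by rewrite /word_prod big_cons.
apply: lower_ideal_word; first by rewrite /= w'n.
by rewrite code_cons addnC ltn_add2r.
Qed.

Lemma perm_word_prod w w' : perm_eq w w' -> word_prod w = word_prod w'.
Proof. by move=> ww'; exact: perm_big. Qed.

(** If the word with one letter i removed lay in its lower ideal, [lower_ideal_cons] would put the
    whole word into its own. *)
Lemma standard_pred n k (i : 'I_s) : (n.+1 < B)%N ->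
  standard n.+1 k -> (0 < digit B i k)%N ->
  [/\ (B ^ i <= k)%N, standard n (k - B ^ i) &
      digit B i k = (digit B i (k - B ^ i)).+1].
Proof.
move=> nB /asboolP[w [wn wk kw]]; rewrite -wk digit_code ?wn// -has_count has_pred1 => iw.
have ww' := perm_to_rem iw; set w' := rem i w in ww'.
have w'n : size w' = n by rewrite size_rem// wn.
have cw : code B w = (B ^ i + code B w')%N by rewrite (perm_code B ww') code_cons.
rewrite cw leq_addr addKn; split => //; last first.
  by rewrite digit_code ?w'n ?(ltnW nB)// (permP ww') /= eqxx.
apply/asboolP; exists w'; split => // w'k; apply: kw.
by rewrite (perm_word_prod ww') -wk cw addnC; exact: lower_ideal_cons.
Qed.

Lemma standard_digits n k : (n < B)%N -> standard n k ->
  (\sum_(i < s) digit B i k)%N = n.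
Proof.
move=> nB /asboolP[w [wn <- _]].
rewrite (eq_bigr (fun i => count_mem i w)); last by move=> i _; rewrite digit_code ?wn.
rewrite -wn; elim: w {wn} => [|j w IH]; first by rewrite big1.
rewrite big_split/= IH (bigD1 j)//= eqxx big1 ?addn0// => i ij.
by rewrite eq_sym (negbTE ij).
Qed.

(** For n < B this is the Hilbert function of the graded ring: the standard monomials of degree n
    give a basis of m^n / m^(n+1) over R / m. *)
Definition hilbert n := (\sum_(0 <= k < B ^ s.+1) standard n k)%N.

(* Dividing a standard monomial of degree n by x_i, x_i^2, ..., as often as x_i
   occurs, gives standard monomials of lower degrees, without repetition. *)
Lemma standard_weight_le n (i : 'I_s) : (n < B)%N ->
  (\sum_(0 <= k < B ^ s.+1) digit B i k * standard n k <= \sum_(j < n) hilbert j)%N.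
Proof.
elim: n => [|n IH] nB.
  rewrite big1// => k _; case: (boolP (standard 0 k)) => [k0|_]; last by rewrite muln0.
  have := standard_digits nB k0; move/eqP; rewrite sum_nat_eq0 => /forallP/(_ i) /=.
  by move=> /eqP ->.
rewrite big_ord_recr/=; apply: leq_trans (leq_add (IH (ltnW nB)) (leqnn _)).
rewrite /hilbert -big_split/=.
have BK : (B ^ i <= B ^ s.+1)%N by rewrite leq_pexp2l ?(leq_trans _ nB)// leqW// ltnW.
rewrite (big_cat_nat (leq0n _) BK)/= big_nat big1 ?add0n; last first.
  move=> k /andP[_ ki]; case: (boolP (standard n.+1 k)) => [k0|_]; last by rewrite muln0.
  by have [->//|/(standard_pred nB k0)[]] := posnP (digit B i k); rewrite leqNgt ki.
rewrite -{1}(add0n (B ^ i)%N) big_addn.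
(* Dividing by x_i lowers the digit by one: the remaining digit belongs to the weight in degree n,
   and the one taken off counts towards [hilbert n]. *)
apply: (@leq_trans (\sum_(0 <= k < B ^ s.+1 - B ^ i) (digit B i k * standard n k + standard n k))).
  apply: leq_sum => k _; case: (boolP (standard n.+1 (k + B ^ i))) => [k0|_]; last by rewrite muln0.
  have [->//|/(standard_pred nB k0)[_]] := posnP (digit B i (k + B ^ i)).
  by rewrite addnK => -> ->; rewrite !muln1 addn1.
by rewrite [leqRHS](big_cat_nat (leq0n _) (leq_subr (B ^ i) _))/= leq_addr.
Qed.

(** The digits of a standard monomial of degree n add up to n, so the weights summed over all i
    count it n times. *)
Lemma hilbert_le n : (n < B)%N -> (n * hilbert n <= s * \sum_(j < n) hilbert j)%N.
Proof.
move=> nB; have -> : (n * hilbert n =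
    \sum_(i < s) \sum_(0 <= k < B ^ s.+1) digit B i k * standard n k)%N.
  rewrite exchange_big /hilbert big_distrr; apply: eq_bigr => k _ /=.
  rewrite -big_distrl/=; case: (boolP (standard n k)) => [k0|_]; last by rewrite !muln0.
  by rewrite (standard_digits nB k0).
apply: (@leq_trans (\sum_(i < s) \sum_(j < n) hilbert j)).
  by apply: leq_sum => i _; exact: standard_weight_le.
by rewrite sum_nat_const card_ord.
Qed.

(** A nonstandard code adds nothing to the ideal. A standard one adds a single monomial y, and u y
    lies in the lower ideal exactly when u is in m: m y is contained in m^(n+1), while a u outside m
    is invertible modulo m and would bring in y. The quotient is thus a copy of R / m. *)
Lemma lower_ideal_index n k : (n < B)%N ->
  ideal_index (lower_ideal n k.+1) (lower_ideal n k) (q ^ standard n k).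
Proof.
move=> nB; case: (boolP (standard n k)) => [|] /asboolP; last first.
  move=> nstd; suff -> : lower_ideal n k.+1 = lower_ideal n k.
    by apply: ideal_index1; exact: is_ideal_lower.
  rewrite eqEsubset; split; last exact: lower_ideal_le.
  apply: smallest_sub; first exact: is_ideal_lower.
  move=> y [|[w [wn]]]; first exact: lower_ideal_expS.
  rewrite ltnS leq_eqVlt => /orP[/eqP wk <-|wk <-]; last exact: lower_ideal_word.
  by apply: contrapT => kw; apply: nstd; exists w.
case=> w [wn wk kw]; rewrite expn1.
have iL := is_ideal_lower n k; set y := word_prod w in kw.
have my u : m u -> lower_ideal n k (u * y).
  move=> mu; apply: lower_ideal_expS; apply: ideal_expSM => //.
  by rewrite -wn; exact: word_prod_exp.
have [f [_ fE fS]] := m_index; exists (fun i => f i * y); split => [i|i j|z].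
- apply: (idealMl _ (is_ideal_lower n k.+1)); apply: lower_ideal_word => //.
  by rewrite wk.
- rewrite -mulrBl => fy; apply: fE; apply: contrapT => mf; apply: kw.
  have [a ma] := m_max mf.
  have -> : y = (1 - a * (f i - f j)) * y + a * ((f i - f j) * y) by ring.
  by apply: (idealD iL); [exact: my|exact: (idealMl _ iL)].
- have sub : lower_ideal n k.+1 `<=` [set z | exists a, lower_ideal n k (z - a * y)].
    apply: smallest_sub.
      split=> [|u v [a ua] [b vb]|d u [a ua]].
      + by exists 0; rewrite mul0r subr0; exact: (ideal0 iL).
      + exists (a + b); have -> : u + v - (a + b) * y = (u - a * y) + (v - b * y) by ring.
        exact: (idealD iL).
      + by exists (d * a); rewrite -mulrA -mulrBr; exact: (idealMl _ iL).
    move=> u [mu|[w' [w'n]]].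
      by exists 0; rewrite mul0r subr0; exact: lower_ideal_expS.
    rewrite ltnS leq_eqVlt => /orP[/eqP w'k <-|w'k <-].
      exists 1; rewrite mul1r /y (@perm_word_prod w' w) ?subrr; first exact: (ideal0 iL).
      by apply: (@code_inj _ B); rewrite ?wn ?w'n// wk.
    by exists 0; rewrite mul0r subr0; exact: lower_ideal_word.
  move=> /sub[a za]; have [i ai] := fS a I; exists i.
  have -> : z - f i * y = (z - a * y) + (a - f i) * y by ring.
  by apply: (idealD iL) => //; exact: my.
Qed.

Lemma ideal_exp_index n : (n < B)%N ->
  ideal_index (ideal_exp m n) (ideal_exp m n.+1) (q ^ hilbert n).
Proof.
move=> nB; rewrite -lower_ideal_max// -lower_ideal0 /hilbert.
elim: (B ^ s.+1)%N => [|k IH].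
  by rewrite big_geq//; apply: ideal_index1; exact: is_ideal_lower.
rewrite big_nat_recr//= expnD mulnC.
apply: (ideal_indexM _ _ _ _ _ (lower_ideal_index _ nB) IH); do ?exact: is_ideal_lower.
  exact: lower_ideal_le.
exact: lower_ideal_le.
Qed.

End HilbertFunction.

Section HilbertGrowth.
Variables (R : comNzRingType) (m : set R) (p : nat).
Hypothesis R_pro_p : pro_p_ring p m.

Lemma maximal_ideal_inv u : maximal_ideal m -> ~ m u -> exists a, m (1 - a * u).
Proof.
(* This is the ideal m + R u, which by maximality contains 1. *)
case=> mI _ mM mu; have iJ : is_ideal [set z | exists a, m (z - a * u)].
  split=> [|z w [a za] [b wb]|d z [a za]].
  - by exists 0; rewrite mul0r subr0; exact: ideal0.
  - exists (a + b); have -> : z + w - (a + b) * u = (z - a * u) + (w - b * u) by ring.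
    exact: idealD.
  - by exists (d * a); rewrite -mulrA -mulrBr; exact: idealMl.
have [z mz|Jm|JT] := mM _ iJ.
- by exists 0; rewrite mul0r subr0.
- case: mu; rewrite -Jm; exists 1; rewrite mul1r subrr; exact: ideal0.
- by have : [set: R] 1 by []; rewrite -JT.
Qed.

Lemma pro_p_ideal_index : exists s (a : nat -> nat),
  (forall n, ideal_index (ideal_exp m n) (ideal_exp m n.+1) (a n)) /\
  (forall n, (a n ^ n <= (\prod_(i < n) a i) ^ s)%N).
Proof.
case: R_pro_p => -[mM _] Rnoeth _ _ finR _.
have mI : is_ideal m by case: mM.
have [l ml] := Rnoeth _ mI; pose x := tnth (in_tuple l).
have mx : m = smallest (@is_ideal R) (range x).
  rewrite {1}ml; congr smallest; rewrite eqEsubset; split=> [y /= yl|_ [i _ <-]] /=.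
    by have /tnthP[i ->] : y \in in_tuple l by []; exists i.
  exact: mem_tnth.
have [q mq] : exists q, ideal_index setT m q.
  have /finite_seqP[cs csE] := finR.
  have /choice[f fP] (i : 'I_(size cs)) : exists u : R,
      tnth (in_tuple cs) i = [set y | m (y - u)].
    have : quotient_set m (tnth (in_tuple cs) i) by rewrite csE /=; exact: mem_tnth.
    by case=> u _ <-; exists u.
  apply: (@class_number_cover _ _ _ f); [exact: ideal_congr_sym|exact: ideal_congr_trans|].
  move=> y; have : quotient_set m [set z | m (z - y)] by exists y.
  rewrite csE => /= /(tnthP (in_tuple cs))[i yi]; exists i.
  suff : [set z | m (z - f i)] y by [].
  by rewrite -fP -yi /mkset subrr; exact: ideal0.
pose a n := (q ^ hilbert m x n.+1 n)%N.
have aP B n : (n < B)%N -> ideal_index (ideal_exp m n) (ideal_exp m n.+1) (q ^ hilbert m x B n).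
  by move=> nB; apply: ideal_exp_index => // u; exact: maximal_ideal_inv.
exists (size l), a; split => n; first exact: aP.
(* The bound B in [a] varies with the degree; uniqueness of the index allows the common bound n + 1
   for all degrees up to n. *)
have -> : (\prod_(i < n) a i = \prod_(i < n) q ^ hilbert m x n.+1 i)%N.
  apply: eq_bigr => i _; apply: ideal_index_uniq (aP _ _ _) (aP _ _ _) => //.
    exact: is_ideal_exp.
  by rewrite ltnS ltnW.
rewrite -expn_sum -!expnM leq_pexp2l//.
  exact: ideal_index_gt0 mq.
by rewrite mulnC [leqRHS]mulnC; exact: hilbert_le.
Qed.

End HilbertGrowth.

Lemma ideal_exp_index_prod (R : comNzRingType) (m : set R) (a : nat -> nat) :
  (forall n, ideal_index (ideal_exp m n) (ideal_exp m n.+1) (a n)) ->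
  forall k n, ideal_index (ideal_exp m k) (ideal_exp m (k + n))
    (\prod_(i < n) a (k + i)%N).
Proof.
move=> aP k; elim=> [|n IH].
  by rewrite addn0 big_ord0; apply: ideal_index1; exact: is_ideal_exp.
rewrite addnS big_ord_recr/=.
apply: (ideal_indexM _ _ _ _ _ IH (aP _)); do ?exact: is_ideal_exp.
  exact: ideal_exp_sub.
by apply: ideal_exp_le; exact: leq_addr.
Qed.

(** * Growth of the partial products *)

Section PartialProducts.
Variables (RR : realType) (a : nat -> nat) (s : nat).
Hypothesis a_gt0 : forall n, (0 < a n)%N.
Hypothesis a_le : forall n, (a n ^ n <= (\prod_(i < n) a i) ^ s)%N.

(* With L n = ln (a_0 ... a_(n-1)), the hypothesis reads n (L (n+1) - L n) <= s L n,
   hence (n - K s) L (n + K) <= n L n. *)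
Lemma partial_prod_shift (K : nat) (e : RR) : 0 < e -> exists2 C : RR, 0 < C &
  forall n, (\prod_(i < n + K) a i)%:R <= C * (\prod_(i < n) a i)%:R `^ (1 + e).
Proof.
move=> e0; pose P n := (\prod_(i < n) a i)%N.
have P0 n : (0 < P n)%N by apply: prodn_gt0.
have P1 n : 1 <= (P n)%:R :> RR by rewrite ler1n.
have Ple n k : (n <= k)%N -> (P n <= P k)%N.
  move=> /subnKC <-; rewrite /P big_split_ord/= leq_pmulr//.
  exact: prodn_gt0.
have lnP n k : (n <= k)%N -> ln (P n)%:R <= ln (P k)%:R :> RR.
  by move=> nk; rewrite ler_ln ?posrE ?ltr0n// ler_nat Ple.
have lnP0 n : 0 <= ln (P n)%:R :> RR by rewrite ln_ge0.
have step n i : (i <= K)%N ->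
    n%:R * (ln (P (n + i)%N)%:R - ln (P n)%:R) <= (i * s)%:R * ln (P (n + K)%N)%:R :> RR.
  elim: i => [|i IH] iK; first by rewrite addn0 subrr mulr0 mul0r.
  have -> : ln (P (n + i.+1)%N)%:R = ln (P (n + i)%N)%:R + ln (a (n + i)%N)%:R :> RR.
    by rewrite addnS /P big_ord_recr/= natrM lnM ?posrE ?ltr0n//; exact: P0.
  rewrite addrAC mulrDr mulSn natrD mulrDl [leRHS]addrC lerD ?(IH (ltnW iK))//.
  have l0 : 0 <= ln (a (n + i)%N)%:R :> RR by rewrite ln_ge0// ler1n.
  apply: (@le_trans _ _ ((n + i)%:R * ln (a (n + i)%N)%:R)).
    by rewrite ler_wpM2r// ler_nat leq_addr.
  rewrite mulr_natl -lnXn ?ltr0n//.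
  apply: (@le_trans _ _ (s%:R * ln (P (n + i)%N)%:R)).
    rewrite mulr_natl -lnXn ?ltr0n// -!natrX ler_ln ?posrE ?ltr0n ?expn_gt0 ?a_gt0 ?P0//.
    by rewrite ler_nat.
  by rewrite ler_wpM2l// lnP// leq_add2l ltnW.
(* From n0 on, (1 + e) K s < e n, that is, n < (1 + e) (n - K s). The finitely many smaller n are
   absorbed by the constant chosen next. *)
pose n0 := Num.bound ((1 + e) * (K * s)%:R / e).
exists (P (n0 + K)%N)%:R; first by rewrite ltr0n.
move=> n; rewrite -!/(P _); have e1 : 0 < 1 + e by rewrite addr_gt0.
have [nn0|n0n] := ltnP n n0.
  apply: (@le_trans _ _ (P (n0 + K)%N)%:R).
    by rewrite ler_nat Ple// leq_add2r ltnW.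
  by rewrite ler_peMr// (le_trans (P1 n))// le1r_powR// lerDl ltW.
apply: (@le_trans _ _ ((P n)%:R `^ (1 + e))); last by rewrite ler_peMl// powR_ge0.
rewrite -ler_ln ?posrE ?powR_gt0 ?ltr0n// ln_powR.
have := step n K (leqnn K).
set L := ln (P (n + K)%N)%:R; set L' := ln (P n)%:R => H.
have Kn : (1 + e) * (K * s)%:R < e * n%:R.
  rewrite mulrC [e * _]mulrC -ltr_pdivrMr// mulrC.
  by apply: lt_le_trans (unstable.ltr_bound _) _; rewrite ler_nat.
have n1 : 0 < n%:R - (K * s)%:R :> RR.
  by have : 0 <= (K * s)%:R :> RR := ler0n _ _; nra.
have L0 : 0 <= L' := lnP0 n.
rewrite -(ler_pM2l n1).
nra.
Qed.

End PartialProducts.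

(** * Standard subgroups and their filtrations *)

Section CosetIndex.
Variable G : groupType.
Implicit Types U V : set G.

Definition coset_eq U (x y : G) := U (x * y^-1)%g.

Lemma coset_eq_sym U : is_subgroup U -> forall x y, coset_eq U x y -> coset_eq U y x.
Proof. by move=> [_ _ UV] x y /UV; rewrite invgM invgK. Qed.

Lemma coset_eq_trans U : is_subgroup U ->
  forall x y z, coset_eq U x y -> coset_eq U y z -> coset_eq U x z.
Proof.
move=> [_ UM _] x y z xy yz; rewrite /coset_eq -(divgK y x) -mulgA; exact: UM.
Qed.

Lemma group_indexE U k : is_subgroup U -> class_number setT (coset_eq U) k ->
  group_index U = k.
Proof.
move=> sU [f [_ fE fS]]; have [U1 UM UV] := sU.
have cosetE x y : coset_eq U x y -> [set (u * x)%g | u in U] = [set (u * y)%g | u in U].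
  move=> xy; rewrite eqEsubset; split=> _ [u Uu <-].
    by exists (u * (x * y^-1))%g; [exact: UM|rewrite -!mulgA mulVg mulg1].
  exists (u * (y * x^-1))%g; first by apply: UM => //; exact: coset_eq_sym xy.
  by rewrite -!mulgA mulVg mulg1.
apply: card_fset_set.
have -> : range (fun x : G => [set (u * x)%g | u in U]) =
    range (fun i => [set (u * f i)%g | u in U]).
  rewrite eqEsubset; split=> [_ [x _ <-]|_ [i _ <-]]; last by exists (f i).
  by have [//|i /cosetE ->] := fS x; exists i.
apply: card_eq_trans (_ : [set: 'I_k] #= _)%card; last by rewrite card_eq_sym card_II.
apply: inj_card_eq => i j _ _ fij; apply: fE.
have : [set (u * f i)%g | u in U] (f i) by exists 1%g => //; rewrite mul1g.
by rewrite fij => -[u Uu uj]; rewrite /coset_eq -uj mulgK.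
Qed.

Lemma coset_indexM U V a b : is_subgroup U -> is_subgroup V -> V `<=` U ->
  class_number setT (coset_eq U) a -> class_number U (coset_eq V) b ->
  class_number setT (coset_eq V) (a * b).
Proof.
move=> sU sV VU [f [_ fE fS]] [g [gU gE gS]]; have [U1 UM UV] := sU.
have -> : (a * b)%N = #|{: 'I_a * 'I_b}| by rewrite card_prod !card_ord.
apply: (class_number_finType (f := fun p => (g p.2 * f p.1)%g)) => [//|[i j] [i' j']|x _] /=.
  move=> Vfg; have ii : i = i'.
    apply: fE; have := VU _ Vfg; rewrite invgM mulgA -(mulgA (g j)) => Ug.
    rewrite /coset_eq; have -> : (f i / f i' =
        (g j)^-1 * (g j * (f i / f i') / g j') * g j')%g.
      by rewrite !mulgA mulVg mul1g divgK.
    by apply: (UM) => //; apply: (UM) => //; exact: UV.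
  subst i'; congr (_, _); apply: gE.
  by move: Vfg; rewrite /coset_eq invgM mulgA mulgK.
have [//|i xi] := fS x; have [j xij] := gS _ xi; exists (i, j) => /=.
by move: xij; rewrite /coset_eq invgM mulgA.
Qed.

End CosetIndex.

Lemma continuous_mulgr (G : topologicalGroupType) (x : G) :
  continuous (fun y : G => (y * x)%g).
Proof.
move=> y; apply: (@continuous2_cvg _ _ _ _ _ _ (fun y => y) (fun=> x) (fun y x => y * x)%g).
- exact: (mulg_continuous (y, x)).
- exact: cvg_id.
- exact: cvg_cst.
Qed.

(** The right cosets form an open cover; a finite subcover may name a coset twice, which
    [class_number_cover] repairs. *)
Lemma compact_open_subgroup_index (G : topologicalGroupType) (U : set G) :
  compact [set: G] -> is_subgroup U -> open U ->
  exists k, class_number setT (coset_eq U) k.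
Proof.
pose Gp : ptopologicalType := HB.pack (TopologicalGroup.sort G) (isPointed.Build G 1%g).
move=> cG sU oU; have [U1 UM UV] := sU.
have : @compact Gp [set: G] by [].
rewrite compact_cover => /(_ Gp setT (fun x => [set y | coset_eq U y x])).
case=> [x _|x _|D _ DU].
- by have /continuousP := @continuous_mulgr G (x^-1)%g; exact.
- by exists x => //=; rewrite /coset_eq divgg.
- pose l := enum_fset D.
  apply: (@class_number_cover _ _ _ (tnth (in_tuple l))).
  + exact: coset_eq_sym.
  + exact: coset_eq_trans.
  + move=> x; have [y yD xy] := DU x I.
    by have /tnthP[i yi] : y \in in_tuple l by []; exists i; rewrite -yi.
Qed.

Section VectorIndex.
Variables (R : comNzRingType) (d : nat).
Implicit Types (I J : set R) (v w : 'rV[R]_d).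

Lemma vec_index I J k : ideal_index I J k ->
  class_number [set v : 'rV_d | forall j, I (v 0 j)]
    (fun v w => forall j, J ((v - w) 0 j)) (k ^ d).
Proof.
move=> [f [fI fE fS]]; have -> : (k ^ d)%N = #|{ffun 'I_d -> 'I_k}|.
  by rewrite card_ffun !card_ord.
apply: (class_number_finType (f := fun h : {ffun 'I_d -> 'I_k} => \row_j f (h j))).
- by move=> h j; rewrite mxE.
- by move=> h h' hh; apply/ffunP => j; apply: fE; have := hh j; rewrite !mxE.
- move=> v vI; have /choice[h hP] j : exists i, J (v 0 j - f i) by exact: fS.
  by exists [ffun j => h j] => j; rewrite !mxE ffunE.
Qed.

End VectorIndex.

Section StandardSubgroup.
Variables (RR : realType) (c : RR) (R : idomainType) (m : set R).
Hypothesis c_gt1 : 1 < c.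
Hypothesis m_sep : \bigcap_n ideal_exp m n = [set 0].
Hypothesis grR : gr_integral_domain m.
Variables (G : topologicalGroupType) (d : nat) (A : set (chart R d G)).
Variables (S : set G) (phi : G -> 'rV[R]_d) (N : nat).
Hypothesis S_std : open_standard_subgroup c m A S phi N.

Local Notation Sn := (natural_filtration m S phi N).
Local Notation vec := (fun n => @vec_in R d (ideal_exp m n)).

Let S1 : S 1%g. Proof. by case: S_std => -[]. Qed.
Let SM x y : S x -> S y -> S (x * y)%g. Proof. by case: S_std => -[_ + _] *; apply. Qed.
Let SV x : S x -> S (x^-1)%g. Proof. by case: S_std => -[_ _ +] *; apply. Qed.

Lemma standard_mul_congr n x x' y y' : S x -> S x' -> S y -> S y' ->
  vec n (phi x - phi x') -> vec n (phi y - phi y') ->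
  vec n (phi (x * y)%g - phi (x' * y')%g).
Proof.
move=> Sx Sx' Sy Sy' xx' yy' i; have [F [_ FE]] := standard_mul S_std.
rewrite !mxE; apply: (integral_series_congr c_gt1 m_sep grR (FE _ _ Sx Sy i) (FE _ _ Sx' Sy' i)).
move=> j; rewrite opp_row_mx add_row_mx mxE.
by case: (fintype.split j) => l; [exact: xx'|exact: yy'].
Qed.

Let vec_refl n x : vec n (phi x - phi x).
Proof. by move=> j; rewrite subrr mxE; exact: ideal0 (is_ideal_exp _ _). Qed.

(** Right multiplication by y and by y^-1 preserves congruences in the chart, which gives the two
    directions. So [phi] turns cosets into congruence classes of vectors, and group indices into
    ideal indices. *)
Lemma natural_filtration_coset n x y : S x -> S y ->
  Sn n (x * y^-1)%g <-> vec (N + n) (phi x - phi y).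
Proof.
move=> Sx Sy; split=> [[Sxy xy]|xy].
  have := @standard_mul_congr (N + n) (x * y^-1)%g 1%g y y Sxy S1 Sy Sy.
  by rewrite divgK mul1g (standard_one S_std) subr0; apply.
split; first exact: SM (SV Sy).
have := @standard_mul_congr (N + n) x y y^-1%g y^-1%g Sx Sy (SV Sy) (SV Sy) xy.
by rewrite divgg (standard_one S_std) subr0; apply.
Qed.

Lemma is_subgroup_natural_filtration n : is_subgroup (Sn n).
Proof.
have SnE x : Sn n x <-> S x /\ vec (N + n) (phi x - phi 1%g).
  by rewrite (standard_one S_std) subr0.
have vec1 : Sn n 1%g by apply/SnE; split.
have SnV x : Sn n x -> Sn n x^-1%g.
  move=> [Sx xn]; rewrite -[x^-1%g]mul1g; apply/natural_filtration_coset => //.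
  rewrite -opprB (standard_one S_std) subr0 => j; rewrite mxE.
  exact: idealN (is_ideal_exp _ _) (xn j).
split=> // x y Snx Sny; have [[Sx xn] [Sy yn]] := (Snx, SnV _ Sny).
rewrite -[y]invgK; apply/natural_filtration_coset => // j.
by rewrite 2!mxE; apply: (idealB (is_ideal_exp _ _)); [exact: xn|exact: yn].
Qed.

Lemma natural_filtration_class_number n k :
  ideal_index (ideal_exp m N) (ideal_exp m (N + n)) k ->
  class_number S (coset_eq (Sn n)) (k ^ d).
Proof.
move=> /(@vec_index _ d)[f [fI fE fS]].
have /choice[g gP] i : exists x, S x /\ phi x = f i.
  have : (phi @` S) (f i) by rewrite (standard_image S_std); exact: fI.
  by case=> x Sx <-; exists x.
have gS i : S (g i) by case: (gP i).
have gE i : phi (g i) = f i by case: (gP i).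
exists g; split=> // [i j|x Sx].
  by move=> /(natural_filtration_coset _ (gS i) (gS j)); rewrite !gE => /fE.
have [|i xi] := fS (phi x); first by rewrite -(standard_image S_std); exists x.
by exists i; apply/natural_filtration_coset => //; rewrite gE.
Qed.

(** The constant k is the index of S in G, and the product is |m^N : m^(N+n)|. *)
Lemma natural_filtration_index (a : nat -> nat) :
  compact [set: G] ->
  (forall n, ideal_index (ideal_exp m n) (ideal_exp m n.+1) (a n)) ->
  exists2 k, (0 < k)%N &
    forall n, group_index (Sn n) = (k * (\prod_(i < n) a (N + i)%N) ^ d)%N.
Proof.
move=> cG aP; have sS := standard_subgroup S_std.
have [k kP] := compact_open_subgroup_index cG sS (standard_open S_std).
exists k; first by case: kP => f [_ _ /(_ 1%g I)[[]]]; case: k f.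
move=> n; apply: group_indexE; first exact: is_subgroup_natural_filtration.
apply: (coset_indexM sS _ _ kP); first exact: is_subgroup_natural_filtration.
  by move=> x [].
by apply: natural_filtration_class_number; exact: ideal_exp_index_prod.
Qed.

End StandardSubgroup.

Section StandardComparison.
Variables (RR : realType) (c : RR) (R : idomainType) (m : set R).
Hypothesis c_gt1 : 1 < c.
Hypothesis m_sep : \bigcap_n ideal_exp m n = [set 0].
Hypothesis grR : gr_integral_domain m.
Variables (G : topologicalGroupType) (d : nat) (A : set (chart R d G)).
Hypothesis A_full : full_atlas c m A.

Lemma natural_filtration_sub S phi N T psi M :
  open_standard_subgroup c m A S phi N -> open_standard_subgroup c m A T psi M ->
  exists k, forall n,
    natural_filtration m S phi N (n + k) `<=` natural_filtration m T psi M n.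
Proof.
move=> sS sT; have [S1 _ _] := standard_subgroup sS.
have [T1 _ _] := standard_subgroup sT.
have [[g [gE gA]] _] := atlas_compatible A_full (standard_chart sS) (standard_chart sT).
have D0 : (phi @` (S `&` T)) 0 by exists 1%g => //; exact: standard_one sS.
have [l [F FP]] := gA _ D0.
have g0 : g 0 = 0.
  have := gE 1%g (conj S1 T1).
  by rewrite /= (standard_one sS) (standard_one sT).
have lip i : exists k, (l <= k)%N /\ forall n x, vec_in (ideal_exp m (n + k)) x ->
    ideal_exp m n (g x 0 i).
  have [|k [lk kP]] := @analytic_lipschitz _ _ _ _ c_gt1 m_sep grR d (F i) l (fun x => g x 0 i).
    by move=> x; rewrite -{1}[x]subr0 => /FP[_ /(_ i)]; rewrite subr0.
  by exists k; split => // n x /kP; rewrite g0 mxE subr0.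
have {lip} /choice[k kP] := lip.
(* The sum dominates the shift of every coordinate, l brings [phi x] into the domain of the
   expansion at 0, and M accounts for the level of T. *)
pose K := (\sum_i k i + l)%N; exists (M + K)%N => n x [Sx xn].
have phix j : (j <= n + M + K)%N -> vec_in (ideal_exp m j) (phi x).
  move=> jn i; apply: ideal_exp_le (xn i); apply: leq_trans jn _.
  by rewrite -addnA leq_addl.
(* Membership in T comes from the domain of the change of charts: [phi x] is also the image of a
   point of S and T, which is x by injectivity on S. *)
have xD : (S `&` T) x.
  have lK : (l <= n + M + K)%N by rewrite addnA leq_addl.
  have [|[y [Sy Ty] /= yx] _] := FP (phi x); first by rewrite subr0; exact: phix.
  have [_ phi_inj _] := atlas_chart A_full (standard_chart sS).
  by have <- : y = x by apply: phi_inj; rewrite ?inE.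
split; first by case: xD.
have /= <- := gE x xD; move=> i; apply: (kP i).2; apply: phix.
by rewrite (addnC M) leq_add2l /K (bigD1 i)//= -!addnA leq_addr.
Qed.

End StandardComparison.

(** * Metrics of two interleaved filtrations *)

Section FiltrationMetrics.
Variables (RR : realType) (G : groupType).
Implicit Types (F : nat -> set G).

Lemma filtration_dist_ge0 F x y : 0 <= filtration_dist RR F x y.
Proof.
rewrite /filtration_dist; case: asboolP => // -[n Fn].
by apply: lb_le_inf => [|_ [k _ <-]]; [exists (group_index (F n))%:R^-1; exists n|].
Qed.

Lemma filtration_dist_le F n x y : F n (x * y^-1)%g ->
  filtration_dist RR F x y <= (group_index (F n))%:R^-1.
Proof.
move=> Fn; rewrite /filtration_dist asboolT; last by exists n.
apply: ge_inf; last by exists n.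
by exists 0 => _ [k _ <-].
Qed.

Lemma filtration_dist_le1 F x y :
  (forall n, (0 < group_index (F n))%N) -> filtration_dist RR F x y <= 1.
Proof.
move=> F0; have [[n Fn]|nF] := pselect (exists n, F n (x * y^-1)%g).
  by apply: le_trans (filtration_dist_le Fn) _; rewrite invf_le1 ?ltr0n ?ler1n.
by rewrite /filtration_dist asboolF.
Qed.

Lemma filtration_dist_holder F F' k (e C : RR) : 0 <= e ->
  (forall n, (0 < group_index (F n))%N) -> (forall n, (0 < group_index (F' n))%N) ->
  (forall n, F (n + k)%N `<=` F' n) ->
  (forall n, (group_index (F (n + k)%N))%:R <= C * (group_index (F' n))%:R `^ (1 + e)) ->
  exists2 C', 0 < C' & forall x y,
    filtration_dist RR F' x y `^ (1 + e) <= C' * filtration_dist RR F x y.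
Proof.
move=> e0 F0 F'0 FF' FC; pose i n : RR := (group_index (F n))%:R.
pose i' n : RR := (group_index (F' n))%:R.
have i0 n : 0 < i n by rewrite ltr0n.
have i'0 n : 0 < i' n by rewrite ltr0n.
pose s := \sum_(n < k) i n; have s0 : 0 <= s by apply: sumr_ge0.
(* The summand s covers the first k terms of F, for which no inclusion into F' is given, |C| covers
   the later ones, and 1 the pairs at the default distance 1. *)
pose C' := 1 + `|C| + s; have C'1 : 1 <= C' by rewrite /C' -addrA lerDl addr_ge0.
have C'0 : 0 < C' := lt_le_trans ltr01 C'1.
have e1 : 0 < 1 + e by rewrite ltr_pwDl.
exists C' => // x y; set z := (x * y^-1)%g.
have pow1 : 1 `^ (1 + e) = 1 :> RR by rewrite powR1.
have d1 : filtration_dist RR F' x y `^ (1 + e) <= 1.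
  rewrite -[leRHS]pow1; apply: ge0_ler_powR; rewrite ?nnegrE ?(ltW e1)//.
    exact: filtration_dist_ge0.
  exact: filtration_dist_le1.
have bound n : F n z -> filtration_dist RR F' x y `^ (1 + e) <= C' / i n.
  move=> Fnz; rewrite ler_pdivlMr//; have [nk|kn] := ltnP n k.
    apply: (@le_trans _ _ (1 * i n)); first by rewrite ler_pM2r.
    rewrite mul1r; apply: (@le_trans _ _ s).
      by rewrite /s (bigD1 (Ordinal nk))//= lerDl sumr_ge0.
    by rewrite /C' lerDr addr_ge0.
  move: kn Fnz => /subnK <-; set j := (n - k)%N => /FF' F'jz.
  apply: (@le_trans _ _ ((i' j)^-1 `^ (1 + e) * (C * i' j `^ (1 + e)))).
    apply: ler_pM; [exact: powR_ge0|exact: ltW| |exact: FC].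
    apply: ge0_ler_powR; rewrite ?nnegrE ?invr_ge0 ?(ltW e1) ?(ltW (i'0 j))//.
      exact: filtration_dist_ge0.
    exact: filtration_dist_le.
  rewrite mulrCA -powRM ?invr_ge0 ?(ltW (i'0 j))// mulVf ?gt_eqF// pow1 mulr1.
  by apply: le_trans (ler_norm _) _; rewrite /C' addrAC lerDr addr_ge0.
have [[n Fn]|nF] := pselect (exists n, F n z); last first.
  by rewrite {2}/filtration_dist asboolF// mulr1; exact: le_trans d1 C'1.
rewrite {2}/filtration_dist asboolT; last by exists n.
rewrite mulrC -ler_pdivrMr//; apply: lb_le_inf; first by exists (i n)^-1; exists n.
by move=> _ [l Fl <-]; rewrite ler_pdivrMr// mulrC; exact: bound.
Qed.

End FiltrationMetrics.

Lemma hDim_natural_filtration_le (RR : realType) (c : RR) (p : nat)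
    (R : idomainType) (m : set R) (G : topologicalGroupType) (d : nat)
    (A : set (chart R d G)) (S T X : set G) (phi psi : G -> 'rV[R]_d) (N M : nat) :
  1 < c -> pro_p_ring p m -> gr_integral_domain m -> full_atlas c m A ->
  compact [set: G] ->
  open_standard_subgroup c m A S phi N -> open_standard_subgroup c m A T psi M ->
  (hDim RR (natural_filtration m T psi M) X <=
   hDim RR (natural_filtration m S phi N) X)%E.
Proof.
move=> c1 Rp grR A_full cG sS sT.
have m_sep : \bigcap_n ideal_exp m n = [set 0] by case: (pro_p_complete Rp).
have [s [a [aP a_le]]] := pro_p_ideal_index Rp.
have a0 n : (0 < a n)%N by apply: ideal_index_gt0 (aP n); exact: is_ideal_exp.
have [u u0 uE] := natural_filtration_index c1 m_sep grR sS cG aP.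
have [v v0 vE] := natural_filtration_index c1 m_sep grR sT cG aP.
have [k kP] := natural_filtration_sub c1 m_sep grR A_full sS sT.
apply: hausdorff_dim_holder => [x y|x y|e e0]; do ?exact: filtration_dist_ge0.
have [C C0 CP] := partial_prod_shift a0 a_le (N + k) e0.
pose P n := (\prod_(i < n) a i)%N.
have P0 n : (0 < P n)%N by apply: prodn_gt0.
have Psplit n l : P (n + l)%N = (P n * \prod_(i < l) a (n + i)%N)%N.
  by rewrite /P big_split_ord.
have e1 : 0 <= 1 + e by rewrite addr_ge0// ltW.
(* Here u = |G : S|, and P M = |R : m^M| converts |m^M : m^(M+n)| into |R : m^(M+n)|; the power d
   counts the coordinates. *)
apply: (filtration_dist_holder (k := k) (C := u%:R * (C * (P M)%:R `^ (1 + e)) ^+ d)).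
- exact: ltW.
- by move=> n; rewrite uE muln_gt0 u0 expn_gt0 prodn_gt0.
- by move=> n; rewrite vE muln_gt0 v0 expn_gt0 prodn_gt0.
- exact: kP.
move=> n; rewrite uE vE; set q := (\prod_(i < n) a (M + i)%N)%N.
have q0 : (0 < q)%N by apply: prodn_gt0.
rewrite !natrM -mulrA ler_wpM2l//.
apply: (@le_trans _ _ ((C * (P M)%:R `^ (1 + e)) ^+ d * (q ^ d)%:R `^ (1 + e))); last first.
  rewrite ler_wpM2l ?exprn_ge0 ?mulr_ge0 ?powR_ge0 ?(ltW C0)//.
  apply: ge0_ler_powR; rewrite ?nnegrE ?mulr_ge0//.
  by rewrite ler_peMl// ler1n.
have -> : (q ^ d)%:R `^ (1 + e) = (q%:R `^ (1 + e)) ^+ d :> RR.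
  by rewrite natrX -powR_mulrn// -powRrM mulrC powRrM powR_mulrn ?powR_ge0.
rewrite natrX -exprMn.
rewrite lerXn2r ?nnegrE ?mulr_ge0 ?powR_ge0 ?(ltW C0)//.
(* The product from N on is enlarged by the first N and by M further factors, so that it becomes a
   partial product at distance N + k from M + n. *)
apply: (@le_trans _ _ (P (M + n + (N + k))%N)%:R).
  rewrite (_ : M + n + (N + k) = N + (n + k) + M)%N; last by lia.
  rewrite ler_nat Psplit (Psplit N) mulnAC leq_pmull// muln_gt0 P0.
  exact: prodn_gt0.
apply: le_trans (CP (M + n)%N) _; rewrite -/(P _) Psplit -/q natrM.
by rewrite powRM// mulrA.
Qed.

Theorem theorem3p1
    (RR : realType) (c : RR) (c_gt1 : 1 < c)
    (p : nat) (R : idomainType) (m : set R)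
    (R_pro_p : pro_p_ring p m) (grR_domain : gr_integral_domain m)
    (G : topologicalGroupType) (d : nat) (A : set (chart R d G))
    (G_analytic : analytic_group c m A) (G_profinite : profinite G)
    (G_infinite : infinite_set [set: G])
    (S : set G) (phi : G -> 'rV[R]_d) (N : nat)
    (S_standard : open_standard_subgroup c m A S phi N)
    (T : set G) (psi : G -> 'rV[R]_d) (M : nat)
    (T_standard : open_standard_subgroup c m A T psi M)
    (H : set G) (H_subgroup : is_subgroup H) (H_closed : closed H) :
  hDim RR (natural_filtration m S phi N) H =
  hDim RR (natural_filtration m T psi M) H.
Proof.
have A_full := analytic_group_atlas G_analytic.
have [G_compact _ _] := G_profinite.
apply/eqP; rewrite eq_le; apply/andP; split.
  exact: (hDim_natural_filtration_le _ c_gt1 R_pro_p grR_domain A_full G_compact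
    T_standard S_standard).
exact: (hDim_natural_filtration_le _ c_gt1 R_pro_p grR_domain A_full G_compact
  S_standard T_standard).
Qed.
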